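(* For every black triangle $\mathsf{b}(y,m)$ and every white triangle $\mathsf{w}(x,n)$ of the graph $G_{\mathbf P}$, the inverse $\mathsf{Kast}^{-1}$ of the Kasteleyn matrix satisfies $$\mathsf{Kast}^{-1}(\mathsf{b}(y,m);\mathsf{w}(x,n))=(-1)^{y-x+m-n}K(x,n;y,m).$$
   Context: Fix $k\ge2$, $N\ge1$ and $A_1<B_1<\dots<A_k<B_k$ in $\mathbb{Z}+\frac12$ with $\sum_i(B_i-A_i)=N$. The polygon $\mathbf P$ in the $(x,n)$ plane is the closure of the set of points $(x,n)$ with $0<n<N$, $A_1+N-n<x<B_k$, and such that for no $i$ does $A_i+N-n\le x\le B_i$ hold. The plane is triangulated by white triangles $\mathsf{w}(x,n)$ with vertices $(x-\frac12,n),(x+\frac12,n),(x+\frac12,n-1)$ and black triangles $\mathsf{b}(x,n)$ with vertices $(x-\frac12,n),(x+\frac12,n),(x-\frac12,n+1)$, $x,n\in\mathbb{Z}$; each triangle is encoded by the midpoint of its horizontal side. $G_{\mathbf P}$ is the bipartite graph whose vertices are the triangles contained in $\mathbf P$, a white and a black triangle being adjacent if they share a side (dimer coverings of $G_{\mathbf P}$ are lozenge tilings of $\mathbf P$). The Kasteleyn matrix $\mathsf{Kast}$ is the adjacency matrix with rows indexed by white and columns by black triangles of $G_{\mathbf P}$: $\mathsf{Kast}(\mathsf{w}(x,n);\mathsf{b}(y,m))=1$ if $(y,m)\in\{(x,n),(x,n-1),(x+1,n-1)\}$ and $0$ otherwise. $\mathsf{Kast}^{-1}$ has rows indexed by black and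 columns by white triangles. Let $\nu_1\ge\dots\ge\nu_N$ be the integers such that $\nu_N-N<\dots<\nu_1-1$ enumerate $\bigcup_i\{A_i+\frac12,\dots,B_i-\frac12\}$. The kernel is, for $1\le n_1\le N$, $0\le n_2\le N-1$, $x_1,x_2\in\mathbb{Z}$, $$K(x_1,n_1;x_2,n_2)=-1_{n_2<n_1}1_{x_2\le x_1}\frac{(x_1-x_2+1)_{n_1-n_2-1}}{(n_1-n_2-1)!}+\frac{(N-n_1)!}{(N-n_2-1)!}\frac1{(2\pi\mathrm{i})^2}\oint dz\oint dw\frac{(z-x_2+1)_{N-n_2-1}}{(w-x_1)_{N-n_1+1}}\frac1{w-z}\prod_{r=1}^N\frac{w+r-\nu_r}{z+r-\nu_r},$$ with $(y)_m=y(y+1)\cdots(y+m-1)$, $(y)_0=1$; both contours counter-clockwise, the $z$ contour containing $x_2,x_2+1,\dots,\nu_1-1$ and not $x_2-1,x_2-2,\dots,\nu_N-N$, and the $w$ contour containing the $z$ contour (without intersecting it) and large enough to include $x_1,x_1-1,\dots,x_1-(N-n_1)$. It is a correlation kernel of the uniform measure on tilings of $\mathbf P$. *)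

(* Defs.v *)
From HB Require Import structures.
From mathcomp Require Import all_boot all_order all_algebra.
From mathcomp Require Import finmap complex.
From mathcomp Require Import all_classical all_reals all_analysis.
Set Implicit Arguments.
Unset Strict Implicit.
Unset Printing Implicit Defensive.
Import Order.TTheory GRing.Theory Num.Theory.
Import numFieldNormedType.Exports.
Local Open Scope classical_set_scope.
Local Open Scope complex_scope.
Local Open Scope ring_scope.

Section Polygon.
Variables (R : realType) (k N : nat) (A B : nat -> R).

(* A i and B i are used for 1 <= i <= k only; a point is (x, n). *)
Definition polygon : set (R * R) :=
  closure [set p : R * R |
    [/\ 0 < p.2 < N%:R,
        A 1%N + N%:R - p.2 < p.1 < B k &
        forall i : nat, (1 <= i <= k)%N ->
          ~ (A i + N%:R - p.2 <= p.1 <= B i)]].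

(* Closed triangle with the given vertices. *)
Definition triangle (u v w : R * R) : set (R * R) :=
  [set p | exists a b c : R,
    [/\ [/\ 0 <= a, 0 <= b & 0 <= c], a + b + c = 1,
        p.1 = a * u.1 + b * v.1 + c * w.1 &
        p.2 = a * u.2 + b * v.2 + c * w.2]].

(* A triangle of either colour is encoded by the midpoint (x, n) of its
   horizontal side. *)
Definition white_triangle (t : int * int) : set (R * R) :=
  let x : R := t.1%:~R in let n : R := t.2%:~R in
  triangle (x - 2^-1, n) (x + 2^-1, n) (x + 2^-1, n - 1).

Definition black_triangle (t : int * int) : set (R * R) :=
  let x : R := t.1%:~R in let n : R := t.2%:~R in
  triangle (x - 2^-1, n) (x + 2^-1, n) (x - 2^-1, n + 1).

(* The two vertex classes of the graph. [fset_set] is the identity on finite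
   sets, and these sets are finite since the polygon is bounded. *)
Definition whites : {fset int * int} :=
  fset_set [set t | white_triangle t `<=` polygon].

Definition blacks : {fset int * int} :=
  fset_set [set t | black_triangle t `<=` polygon].

Definition share_side (w b : int * int) : bool :=
  b \in [:: (w.1, w.2); (w.1, w.2 - 1); (w.1 + 1, w.2 - 1)].

(* Row w is at index [enum_rank w], column b at index [enum_rank b]. *)
Definition Kast : 'M[R[i]]_(#|{: whites}|, #|{: blacks}|) :=
  \matrix_(i, j) (share_side (val (enum_val i)) (val (enum_val j)))%:R.

(* nu r is used for 1 <= r <= N only. *)
Definition top_row (nu : nat -> int) : Prop :=
  [/\ forall r : nat, (1 <= r < N)%N -> nu r.+1 <= nu r,
      forall r : nat, (1 <= r < N)%N -> nu r.+1 - r.+1%:Z < nu r - r%:Z &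
      forall p : int,
        (exists2 r : nat, (1 <= r <= N)%N & nu r - r%:Z = p) <->
        (exists2 i : nat, (1 <= i <= k)%N &
          A i + 2^-1 <= p%:~R <= B i - 2^-1)].

End Polygon.

(* Two-sided inverse between a priori differently indexed rows and columns. *)
Definition is_inverse_mx (F : nzRingType) (m n : nat)
    (M : 'M[F]_(m, n)) (M' : 'M[F]_(n, m)) : Prop :=
  M *m M' = 1%:M /\ M' *m M = 1%:M.

Section Contours.
Variable R : realType.
Local Notation C := R[i].
Implicit Types (g : R -> C) (f : C -> C) (p : C).

Definition Re_path g : R -> R := fun t => complex.Re (g t).
Definition Im_path g : R -> R := fun t => complex.Im (g t).

Definition velocity g (t : R) : C :=
  @Complex R (derive1 (Re_path g) t) (derive1 (Im_path g) t).

Definition C1_path g : Prop :=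
  (forall t : R, derivable (Re_path g) t 1 /\ derivable (Im_path g) t 1) /\
  continuous (derive1 (Re_path g)) /\ continuous (derive1 (Im_path g)).

(* Curves are parametrized by [0, 1]; on each closed subinterval of some
   subdivision the curve agrees with a C^1 function defined on the whole line,
   i.e. it is C^1 there up to the end points. *)
Definition piecewise_C1 g : Prop :=
  exists2 s : seq R, itv_partition 0 1 s &
    forall j : nat, (j < size s)%N ->
      exists2 h : R -> C, C1_path h &
        forall t : R, nth 0 (0 :: s) j <= t <= nth 0 (0 :: s) j.+1 -> g t = h t.

(* The finitely many parameters where the velocity may be a junk value do not
   affect the integral. *)
Definition contour_integral g f : C :=
  @Complex R
    (\int[lebesgue_measure]_(t in `[0, 1]) complex.Re (f (g t) * velocity g t))
    (\int[lebesgue_measure]_(t in `[0, 1]) complex.Im (f (g t) * velocity g t)).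

Definition two_pi_i : C := @Complex R 0 (2 * pi).

Definition winding g p : C :=
  two_pi_i^-1 * contour_integral g (fun z => (z - p)^-1).

Definition on_curve g p : Prop := exists2 t : R, 0 <= t <= 1 & g t = p.

(* Simple closed curve traversed counter-clockwise: the winding number is 1
   around the points inside and 0 around the points outside. *)
Definition ccw_contour g : Prop :=
  [/\ piecewise_C1 g, g 0 = g 1,
      forall s t : R, 0 <= s < 1 -> 0 <= t < 1 -> g s = g t -> s = t &
      forall p, ~ on_curve g p -> winding g p = 0 \/ winding g p = 1].

Definition encloses g p : Prop := ~ on_curve g p /\ winding g p = 1.
Definition excludes g p : Prop := ~ on_curve g p /\ winding g p = 0.

End Contours.

Section Kernel.
Variables (R : realType) (N : nat) (nu : nat -> int).
Local Notation C := R[i].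

Definition pochhammer (y : C) (m : nat) : C := \prod_(0 <= j < m) (y + j%:R).

Definition z_contour (gz : R -> C) (x2 : int) : Prop :=
  [/\ ccw_contour gz,
      forall p : int, x2 <= p <= nu 1%N - 1 -> encloses gz p%:~R &
      forall p : int, nu N - N%:Z <= p <= x2 - 1 -> excludes gz p%:~R].

Definition w_contour (gw gz : R -> C) (x1 n1 : int) : Prop :=
  [/\ ccw_contour gw,
      forall t : R, 0 <= t <= 1 -> encloses gw (gz t) &
      forall p : int, x1 - (N%:Z - n1) <= p <= x1 -> encloses gw p%:~R].

(* Meant for 1 <= n1 <= N and 0 <= n2 <= N - 1, where the arguments of absz
   below are nonnegative whenever the term they occur in is present. *)
Definition corr_kernel (gz gw : R -> C) (x1 n1 x2 n2 : int) : C :=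
  - (if (n2 < n1) && (x2 <= x1) then
       pochhammer (x1 - x2 + 1)%:~R (absz (n1 - n2 - 1)%R) /
         (absz (n1 - n2 - 1)%R)`!%:R
     else 0)
  + (absz (N%:Z - n1)%R)`!%:R / (absz (N%:Z - n2 - 1)%R)`!%:R * (two_pi_i R ^+ 2)^-1 *
    contour_integral gz (fun z =>
      contour_integral gw (fun w =>
        pochhammer (z - x2%:~R + 1) (absz (N%:Z - n2 - 1)%R) /
        pochhammer (w - x1%:~R) (absz (N%:Z - n1 + 1)%R) *
        (w - z)^-1 *
        \prod_(1 <= r < N.+1)
          ((w + r%:R - (nu r)%:~R) / (z + r%:R - (nu r)%:~R)))).

End Kernel.

(* Main.v *)
Require Import Defs.
From HB Require Import structures.
From mathcomp Require Import all_boot all_order all_algebra.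
From mathcomp Require Import finmap complex.
From mathcomp Require Import all_classical all_reals all_analysis.
From mathcomp Require Import measurable_realfun.
From mathcomp Require Import ring lra zify.
Set Implicit Arguments.
Unset Strict Implicit.
Unset Printing Implicit Defensive.
Import Order.TTheory GRing.Theory Num.Theory.
Import numFieldNormedType.Exports.
Local Open Scope classical_set_scope.
Local Open Scope complex_scope.
Local Open Scope ring_scope.

(* Both contour integrals reduce to residues.  With Pi the product of X - p over
   the top particles p and D the product of the X - (x - j), 0 <= j <= N - n,
   all poles of the w integral are enclosed, so it equals the polynomial part
   P = Pi / D at z, and the z integral leaves a finite sum over the particles
   p >= y.  Writing phi_j(d) for the binomial coefficient C(d + j - 1, j - 1)
   cut off at d >= 0,
     K(x,n;y,m) = - phi_(n-m)(x-y)
                  + (N-n)! sum_p phi_(N-m)(p-y) P(p) / prod_(q <> p) (p - q).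
   Pascal's rule for phi gives
     K(.;x',n') - K(.;x',n'-1) + K(.;x'+1,n'-1) = delta,
   which is Kast * Kast^-1 = 1 up to signs, except that some of the black
   triangles involved may not lie in the polygon.  Next to a white triangle of
   the graph these can only be at y = B_k + 1/2, where K vanishes trivially, or
   just left of the slanted side.  There the cut-off in phi may be dropped and
   the sum over p becomes a divided difference of a binomial polynomial over
   the roots of Pi, which equals the one over the roots of D, i.e. an iterated
   finite difference, and cancels the first term.  Finally there are as many
   white as black triangles, so a right inverse is a two-sided inverse. *)

(** * Contour integrals *)

Section PiecewiseIntegral.
Variable R : realType.
Local Notation mu := (@lebesgue_measure R).
Implicit Types (F f G : R -> R) (a b c : R) (s : seq R).

Lemma integrable_point a f : mu.-integrable [set a] (EFin \o f).
Proof.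
apply: null_set_integrable => //; first exact: measurable_fun_set1.
exact: lebesgue_measure_set1.
Qed.

Lemma integrable_oo_cc a b f :
  mu.-integrable `]a, b[ (EFin \o f) -> mu.-integrable `[a, b] (EFin \o f).
Proof.
move=> ifab.
apply/integrableP; case/integrableP : ifab => mf fi; split.
  exact: (@emeasurable_fun_itv_cc _ a b false true).
rewrite (@integral_itv_bndoo _ _ _ (fun x => `|(EFin \o f) x|%E) true false) //.
exact: measurableT_comp.
Qed.

Lemma integrable_cc_cat a b c f : a <= c -> c <= b ->
  mu.-integrable `[a, c] (EFin \o f) -> mu.-integrable `[c, b] (EFin \o f) ->
  mu.-integrable `[a, b] (EFin \o f) /\
  \int[mu]_(t in `[a, b]) f t =
  \int[mu]_(t in `[a, c]) f t + \int[mu]_(t in `[c, b]) f t.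
Proof.
move=> ac cb iac icb.
have U : [set` `[a, b]] = [set` `[a, c]] `|` [set` `]c, b]] :> set R.
  by rewrite -itv_bndbnd_setU // bnd_simp.
have ac_cb : [disjoint [set` `[a, c]] & [set` `]c, b]]].
  rewrite disj_set2E; apply/eqP/seteqP; split => // x [] /=.
  by rewrite !in_itv /= => /andP[_ xc] /andP[+ _]; rewrite ltNge xc.
have i2 : mu.-integrable `]c, b] (EFin \o f).
  by apply: integrableS icb => //; apply: subset_itvr; rewrite bnd_simp.
have iab : mu.-integrable `[a, b] (EFin \o f).
  have mf : measurable_fun ([set` `[a, c]] `|` [set` `]c, b]]) (EFin \o f).
    apply/measurable_funU => //.
    by split; [case/integrableP: iac|case/integrableP: i2].
  apply/integrableP; rewrite U; split => //.
  rewrite ge0_integral_setU //=.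
  - by apply: lte_add_pinfty; [case/integrableP: iac|case/integrableP: i2].
  - exact/measurable_EFinP/measurableT_comp/measurable_EFinP.
split => //.
rewrite U Rintegral_setU //.
- by congr (_ + _); rewrite Rintegral_itv_obnd_cbnd.
- by rewrite -U.
Qed.

(** End points have measure zero. Only the open interval is compared because the velocity of a
    piecewise path is uncontrolled at subdivision points. *)
Lemma integrable_cc_congr a b f G :
  (forall t, a < t < b -> f t = G t) -> mu.-integrable `[a, b] (EFin \o G) ->
  mu.-integrable `[a, b] (EFin \o f) /\
  \int[mu]_(t in `[a, b]) f t = \int[mu]_(t in `[a, b]) G t.
Proof.
move=> fG iG.
have iGo : mu.-integrable `]a, b[ (EFin \o G).
  by apply: integrableS iG => //; apply: subset_itv_oo_cc.
have ifo : mu.-integrable `]a, b[ (EFin \o f).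
  apply: eq_integrable iGo => // t; rewrite inE /= in_itv /= => tab.
  by rewrite /= fG.
split; first exact: integrable_oo_cc.
rewrite /Rintegral; congr fine; apply: eq_integral_itv_bounded.
- by case/integrableP: ifo => /measurable_EFinP.
- by case/integrableP: iGo => /measurable_EFinP.
- by move=> t; rewrite in_itv /= => tab; rewrite fG.
Qed.

Lemma piecewise_integrable a b s f : itv_partition a b s ->
  (forall j, (j < size s)%N -> exists2 G : R -> R,
    (forall t, nth 0 (a :: s) j <= t <= nth 0 (a :: s) j.+1 ->
      {for t, continuous G}) &
    forall t, nth 0 (a :: s) j < t < nth 0 (a :: s) j.+1 -> f t = G t) ->
  mu.-integrable `[a, b] (EFin \o f).
Proof.
elim: s a => [|c s IH] a part pw.
  rewrite (itv_partition_nil part) set_itv1.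
  exact: integrable_point.
have part' := itv_partition_cons part.
have ac : a <= c by case: part => /= /andP[/ltW].
apply: (@integrable_cc_cat a b c f _ _ _ _).1 => //.
- exact: itv_partition_le part'.
- have [G cG fG] := pw 0%N isT.
  apply: (@integrable_cc_congr _ _ _ G _ _).1 => //.
  apply: continuous_compact_integrable; first exact: segment_compact.
  apply: continuous_in_subspaceT => t; rewrite inE /= in_itv /= => tac.
  exact: cG.
- apply: IH => // j js; have [G cG fG] := pw j.+1 js.
  by exists G.
Qed.

(** The fundamental theorem on each piece, then telescoping. [F] has to match the primitives on
    closed pieces so that boundary values cancel; [f] has to match the derivatives on open pieces
    only. *)
Lemma piecewise_FTC a b s F f : itv_partition a b s ->
  (forall j, (j < size s)%N -> exists2 G : R -> R,
    (forall t, derivable G t 1) /\ continuous (derive1 G) &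
    (forall t, nth 0 (a :: s) j <= t <= nth 0 (a :: s) j.+1 -> F t = G t) /\
    (forall t, nth 0 (a :: s) j < t < nth 0 (a :: s) j.+1 -> f t = derive1 G t)) ->
  \int[mu]_(t in `[a, b]) f t = F b - F a.
Proof.
move=> part pw.
suff : mu.-integrable `[a, b] (EFin \o f) /\
  \int[mu]_(t in `[a, b]) f t = F b - F a by case.
elim: s a part pw => [|c s IH] a part pw.
  rewrite (itv_partition_nil part) set_itv1 Rintegral_set1 subrr; split => //.
  exact: integrable_point.
have part' := itv_partition_cons part.
have ac : a < c by case: part => /= /andP[].
have [|ib eb] := IH c part'.
  by move=> j js; exact: (pw j.+1 js).
have [G [dG cG] [FG fG]] := pw 0%N isT.
have cwG : {within `[a, c], continuous (derive1 G)}.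
  by apply: continuous_in_subspaceT => t _; exact: cG.
have iG : mu.-integrable `[a, c] (EFin \o derive1 G).
  by apply: continuous_compact_integrable => //; exact: segment_compact.
have [ia ea] := integrable_cc_congr fG iG.
have [iab eab] := integrable_cc_cat (ltW ac) (itv_partition_le part') ia ib.
split => //; rewrite eab eb ea /=.
have ctG : continuous G.
  by move=> t; apply/differentiable_continuous/derivable1_diffP/dG.
rewrite /Rintegral (@continuous_FTC2 _ _ G) //; last first.
  split; first by move=> t _; exact: dG.
  - exact/cvg_at_right_filter/ctG.
  - exact/cvg_at_left_filter/ctG.
rewrite /= -!FG /= ?lexx ?ltW //.
by ring.
Qed.

End PiecewiseIntegral.

(** * Paths in the complex plane, by real and imaginary parts *)

Section ComplexPaths.
Variable R : realType.
Local Notation C := R[i].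
Local Notation mu := (@lebesgue_measure R).
Implicit Types (g h : R -> C) (f : C -> C) (t : R) (a c : C) (p : {poly C}).

Lemma Re_mulc (x y : C) :
  complex.Re (x * y) = complex.Re x * complex.Re y - complex.Im x * complex.Im y.
Proof. by case: x; case: y. Qed.

Lemma Im_mulc (x y : C) :
  complex.Im (x * y) = complex.Re x * complex.Im y + complex.Im x * complex.Re y.
Proof. by case: x; case: y. Qed.

Lemma Re_addc (x y : C) : complex.Re (x + y) = complex.Re x + complex.Re y.
Proof. by case: x; case: y. Qed.

Lemma Im_addc (x y : C) : complex.Im (x + y) = complex.Im x + complex.Im y.
Proof. by case: x; case: y. Qed.

(** Continuity by components, since [contour_integral] is itself a pair of real integrals. *)
Definition ccontinuous_at t h : Prop :=
  {for t, continuous (Re_path h)} /\ {for t, continuous (Im_path h)}.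

Lemma ccontinuous_cst t c : ccontinuous_at t (fun=> c).
Proof. by split; apply: cst_continuous. Qed.

Lemma ccontinuousD t g h : ccontinuous_at t g -> ccontinuous_at t h ->
  ccontinuous_at t (fun u => g u + h u).
Proof.
move=> [g1 g2] [h1 h2]; split.
- rewrite (_ : Re_path _ = Re_path g \+ Re_path h); first exact: continuousD.
  by apply/funext => u; rewrite /Re_path Re_addc.
- rewrite (_ : Im_path _ = Im_path g \+ Im_path h); first exact: continuousD.
  by apply/funext => u; rewrite /Im_path Im_addc.
Qed.

Lemma ccontinuousM t g h : ccontinuous_at t g -> ccontinuous_at t h ->
  ccontinuous_at t (fun u => g u * h u).
Proof.
move=> [g1 g2] [h1 h2]; split.
- rewrite (_ : Re_path _ = Re_path g \* Re_path h \- Im_path g \* Im_path h).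
    by apply: continuousB; apply: continuousM.
  by apply/funext => u; rewrite /Re_path Re_mulc.
- rewrite (_ : Im_path _ = Re_path g \* Im_path h \+ Im_path g \* Re_path h).
    by apply: continuousD; apply: continuousM.
  by apply/funext => u; rewrite /Im_path Im_mulc.
Qed.

(** For h = x + iy the inverse is (x - iy) / (x^2 + y^2), and the denominator vanishes only where h
    does. *)
Lemma ccontinuousV t h : ccontinuous_at t h -> h t != 0 ->
  ccontinuous_at t (fun u => (h u)^-1).
Proof.
move=> [h1 h2] ht.
have cn : {for t, continuous
    (fun u => (Re_path h u ^+ 2 + Im_path h u ^+ 2)^-1)}.
  apply: continuousV; last by apply: continuousD; apply: continuousM.
  apply: contra ht => /eqP ht.
  have := ht => /eqP; rewrite paddr_eq0 ?sqr_ge0 // !sqrf_eq0 /Re_path /Im_path.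
  by case: (h t) => x y /= /andP[/eqP -> /eqP ->].
split.
- rewrite (_ : Re_path _ = fun u => Re_path h u *
      (Re_path h u ^+ 2 + Im_path h u ^+ 2)^-1).
    exact: continuousM.
  by apply/funext => u; rewrite /Re_path /Im_path; case: (h u).
- rewrite (_ : Im_path _ = fun u => - (Im_path h u *
      (Re_path h u ^+ 2 + Im_path h u ^+ 2)^-1)).
    by apply: continuousN; apply: continuousM.
  by apply/funext => u; rewrite /Re_path /Im_path; case: (h u).
Qed.

Lemma ccontinuous_horner t h p : ccontinuous_at t h ->
  ccontinuous_at t (fun u => p.[h u]).
Proof.
move=> ch; elim/poly_ind: p => [|p c IH].
  rewrite (_ : (fun _ => _) = fun=> 0); first exact: ccontinuous_cst.
  by apply/funext => u; rewrite horner0.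
rewrite (_ : (fun _ => _) = fun u => p.[h u] * h u + c).
  by apply: ccontinuousD; [exact: ccontinuousM|exact: ccontinuous_cst].
by apply/funext => u; rewrite hornerMXaddC.
Qed.

Lemma C1_path_ccontinuous t h : C1_path h -> ccontinuous_at t h.
Proof.
move=> [dh _]; split.
- by apply/differentiable_continuous/derivable1_diffP; case: (dh t).
- by apply/differentiable_continuous/derivable1_diffP; case: (dh t).
Qed.

Lemma C1_path_ccontinuous_velocity t h :
  C1_path h -> ccontinuous_at t (velocity h).
Proof. by move=> [_ [h1 h2]]; split; [exact: h1|exact: h2]. Qed.

Lemma C1_pathP h v : (forall t, ccontinuous_at t v) ->
  (forall t, is_derive t 1 (Re_path h) (Re_path v t) /\
             is_derive t 1 (Im_path h) (Im_path v t)) ->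
  C1_path h /\ velocity h = v.
Proof.
move=> cv dh.
have hR : derive1 (Re_path h) = Re_path v.
  by apply/funext => t; rewrite derive1E; case: (dh t) => d _; apply: derive_val.
have hI : derive1 (Im_path h) = Im_path v.
  by apply/funext => t; rewrite derive1E; case: (dh t) => _ d; apply: derive_val.
split.
  split; first by move=> t; case: (dh t) => [[? _] [? _]].
  by rewrite hR hI; split => t; case: (cv t).
apply/funext => t; rewrite /velocity hR hI /Re_path /Im_path.
by case: (v t).
Qed.

Lemma C1_path_is_derive t h : C1_path h ->
  is_derive t 1 (Re_path h) (Re_path (velocity h) t) /\
  is_derive t 1 (Im_path h) (Im_path (velocity h) t).
Proof.
move=> [dh _]; have [d1 d2] := dh t.
by rewrite /Re_path /Im_path /= !derive1E; split; apply/derivableP.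
Qed.

(** The chain rule, by induction on the form p X + c: the product rule is expanded in real and
    imaginary parts. *)
Lemma C1_path_horner h p : C1_path h ->
  C1_path (fun t => p.[h t]) /\
  velocity (fun t => p.[h t]) = fun t => p^`().[h t] * velocity h t.
Proof.
move=> Ch; apply: C1_pathP => [t|].
  apply: ccontinuousM; last exact: C1_path_ccontinuous_velocity.
  exact/ccontinuous_horner/C1_path_ccontinuous.
elim/poly_ind: p => [|p c IH] t.
  rewrite /Re_path /Im_path deriv0.
  rewrite (_ : (fun t => complex.Re 0.[h t]) = cst 0); last first.
    by apply/funext => u; rewrite horner0.
  rewrite (_ : (fun t => complex.Im 0.[h t]) = cst 0); last first.
    by apply/funext => u; rewrite horner0.
  by rewrite horner0 mul0r; split; apply: is_derive_cst.
have [p1 p2] := IH t; have [h1 h2] := C1_path_is_derive t Ch.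
move: (velocity h) p1 p2 h1 h2 => v p1 p2 h1 h2.
rewrite derivD derivC addr0 derivM derivX mulr1.
split.
- rewrite (_ : Re_path _ = (Re_path (fun t => p.[h t]) * Re_path h -
    Im_path (fun t => p.[h t]) * Im_path h + cst (complex.Re c))%R); last first.
    by apply/funext => u; rewrite /Re_path !hornerE Re_addc Re_mulc.
  apply: is_derive_eq.
  rewrite /Re_path /Im_path /GRing.scale /= hornerD hornerMX.
  rewrite !(Re_addc, Re_mulc, Im_addc, Im_mulc, mulrDl).
  ring.
- rewrite (_ : Im_path _ = (Re_path (fun t => p.[h t]) * Im_path h +
    Im_path (fun t => p.[h t]) * Re_path h + cst (complex.Im c))%R); last first.
    by apply/funext => u; rewrite /Im_path !hornerE Im_addc Im_mulc.
  apply: is_derive_eq.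
  rewrite /Re_path /Im_path /GRing.scale /= hornerD hornerMX.
  rewrite !(Re_addc, Re_mulc, Im_addc, Im_mulc, mulrDl).
  ring.
Qed.

End ComplexPaths.

(** * Contour integrals: linearity, polynomials and simple poles *)

Section ContourIntegral.
Variable R : realType.
Local Notation C := R[i].
Local Notation mu := (@lebesgue_measure R).
Implicit Types (g h : R -> C) (f : C -> C) (a c z : C) (p : {poly C}) (s : seq C).

Definition contour_integrable g f : Prop :=
  mu.-integrable `[0, 1] (EFin \o (fun t => complex.Re (f (g t) * velocity g t))) /\
  mu.-integrable `[0, 1] (EFin \o (fun t => complex.Im (f (g t) * velocity g t))).

Lemma eq_contour_integral g f1 f2 :
  (forall t, 0 <= t <= 1 -> f1 (g t) = f2 (g t)) ->
  contour_integral g f1 = contour_integral g f2.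
Proof.
by move=> f12; rewrite /contour_integral; congr Complex;
  apply: eq_Rintegral => t; rewrite inE /= in_itv /= => t01; rewrite f12.
Qed.

Lemma contour_integrableD g f1 f2 :
  contour_integrable g f1 -> contour_integrable g f2 ->
  contour_integrable g (fun z => f1 z + f2 z).
Proof.
move=> [r1 i1] [r2 i2]; split.
- apply: eq_integrable (integrableD _ r1 r2) => // t _.
  by rewrite /= mulrDl Re_addc.
- apply: eq_integrable (integrableD _ i1 i2) => // t _.
  by rewrite /= mulrDl Im_addc.
Qed.

Lemma addcE (x y u v : R) : (x +i* y) + (u +i* v) = (x + u) +i* (y + v) :> C.
Proof. by []. Qed.

Lemma mulcE (x y u v : R) :
  (x +i* y) * (u +i* v) = (x * u - y * v) +i* (x * v + y * u) :> C.
Proof. by []. Qed.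

Lemma contour_integralD g f1 f2 :
  contour_integrable g f1 -> contour_integrable g f2 ->
  contour_integral g (fun z => f1 z + f2 z) =
  contour_integral g f1 + contour_integral g f2.
Proof.
move=> [r1 i1] [r2 i2]; rewrite /contour_integral.
rewrite addcE; congr Complex.
- rewrite -RintegralD //; apply: eq_Rintegral => t _.
  by rewrite mulrDl Re_addc.
- rewrite -RintegralD //; apply: eq_Rintegral => t _.
  by rewrite mulrDl Im_addc.
Qed.

Lemma contour_integrableZ g f c :
  contour_integrable g f -> contour_integrable g (fun z => c * f z).
Proof.
move=> [r1 i1]; split.
- apply: eq_integrable (integrableB _ (integrableZl _ (complex.Re c) r1)
    (integrableZl _ (complex.Im c) i1)) => // t _.
  by rewrite /= -mulrA (Re_mulc c).
- apply: eq_integrable (integrableD _ (integrableZl _ (complex.Re c) i1)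
    (integrableZl _ (complex.Im c) r1)) => // t _.
  by rewrite /= -mulrA (Im_mulc c).
Qed.

Lemma contour_integralZ g f c : contour_integrable g f ->
  contour_integral g (fun z => c * f z) = c * contour_integral g f.
Proof.
move=> [r1 i1]; rewrite /contour_integral.
have Z (k : R) (F : R -> R) : mu.-integrable `[0, 1] (EFin \o F) ->
    mu.-integrable `[0, 1] (EFin \o (fun t => k * F t)).
  by move=> iF; apply: eq_integrable (integrableZl _ k iF).
case: c => x y; rewrite mulcE; congr Complex.
- rewrite -!RintegralZl // -RintegralB //; [|exact: Z|exact: Z].
  by apply: eq_Rintegral => t _; rewrite -mulrA Re_mulc.
- rewrite -!RintegralZl // -RintegralD //; [|exact: Z|exact: Z].
  by apply: eq_Rintegral => t _; rewrite -mulrA Im_mulc.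
Qed.

Lemma contour_integral_sum g (I : eqType) (r : seq I) (F : I -> C -> C) :
  (forall i, i \in r -> contour_integrable g (F i)) ->
  contour_integrable g (fun z => \sum_(i <- r) F i z) /\
  contour_integral g (fun z => \sum_(i <- r) F i z) =
  \sum_(i <- r) contour_integral g (F i).
Proof.
elim: r => [|i r IH] iF.
  rewrite (_ : (fun z => _) = (fun=> 0)); last first.
    by apply/funext => z; rewrite big_nil.
  have i0 : contour_integrable g (fun=> 0).
    split; (rewrite [X in integrable _ _ X](_ : _ = cst 0%E);
      first exact: integrable0); by apply: funext => t; rewrite /comp mul0r.
  split => //; rewrite big_nil.
  transitivity (contour_integral g (fun _ => 0 * 0)).
    by apply: eq_contour_integral => t _; rewrite mul0r.
  by rewrite contour_integralZ // mul0r.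
have [|IH1 IH2] := IH; first by move=> j jr; apply: iF; rewrite inE jr orbT.
have ii : contour_integrable g (F i) by apply: iF; rewrite mem_head.
rewrite (_ : (fun z => _) = (fun z => F i z + \sum_(i <- r) F i z)); last first.
  by apply/funext => z; rewrite big_cons.
split; first exact: contour_integrableD.
by rewrite contour_integralD // big_cons IH2.
Qed.

Lemma near_eq_derive1 (F G : R -> R) (t : R) : (\near t, F t = G t) ->
  derive1 F t = derive1 G t.
Proof.
by move=> FG; rewrite !derive1E; apply: near_eq_derive; rewrite ?oner_neq0.
Qed.

Lemma velocity_oo g h (x y t : R) : (forall u, x <= u <= y -> g u = h u) ->
  x < t < y -> velocity g t = velocity h t.
Proof.
move=> gh xty.
have nt : \near t, g t = h t.
  have : t \in `]x, y[ by rewrite in_itv.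
  move=> /near_in_itvoo; apply: filterS => u; rewrite in_itv /= => /andP[xu uy].
  by apply: gh; rewrite !ltW.
rewrite /velocity; congr Complex; apply: near_eq_derive1;
  by apply: filterS nt => u; rewrite /Re_path /Im_path => ->.
Qed.

(** The hypothesis tests [f] along every [h] through g(t), because on each piece [g] is replaced by
    a globally smooth [h] that may leave the curve outside that piece. *)
Lemma contour_integrable_continuous g f : piecewise_C1 g ->
  (forall h t, 0 <= t <= 1 -> g t = h t -> ccontinuous_at t h ->
     ccontinuous_at t (fun u => f (h u))) ->
  contour_integrable g f.
Proof.
move=> [s part pw] cf.
suff H j : (j < size s)%N -> exists2 G : R -> C,
    (forall t, nth 0 (0 :: s) j <= t <= nth 0 (0 :: s) j.+1 ->
      ccontinuous_at t G) &
    forall t, nth 0 (0 :: s) j < t < nth 0 (0 :: s) j.+1 ->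
      f (g t) * velocity g t = G t.
  by split; apply: (piecewise_integrable part) => j js;
    have [G cG fG] := H j js; [exists (Re_path G)|exists (Im_path G)] => t tj;
    rewrite ?fG //; case: (cG t tj).
move=> js; have [h Ch gh] := pw j js.
exists (fun u => f (h u) * velocity h u) => t tj; last first.
  rewrite (velocity_oo gh tj) gh //.
  by case/andP: tj => /ltW -> /ltW ->.
apply: ccontinuousM; last exact: C1_path_ccontinuous_velocity.
apply: cf; [|exact: gh|exact: C1_path_ccontinuous].
case/andP: tj => tj1 tj2; apply/andP; split.
  apply: le_trans tj1; rewrite (set_nth_default 1); last by rewrite /= ltnS ltnW.
  by apply: itv_partition_nth_ge part; rewrite ltnS ltnW.
apply: (le_trans tj2); rewrite (set_nth_default 1); last by rewrite /= ltnS.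
by apply: itv_partition_nth_le part.
Qed.

(** The real fundamental theorem applies to both parts of p(g(t)), whose derivative on each piece
    comes from the chain rule. *)
Lemma contour_integral_deriv g p : piecewise_C1 g ->
  contour_integral g (fun z => p^`().[z]) = p.[g 1] - p.[g 0].
Proof.
move=> [s part pw]; rewrite /contour_integral.
rewrite (_ : p.[g 1] - p.[g 0] =
    (Re_path (fun t => p.[g t]) 1 - Re_path (fun t => p.[g t]) 0) +i*
    (Im_path (fun t => p.[g t]) 1 - Im_path (fun t => p.[g t]) 0)); last first.
  by rewrite /Re_path /Im_path; case: (p.[g 1]); case: (p.[g 0]).
congr Complex; apply: (piecewise_FTC part) => j js; have [h Ch gh] := pw j js;
  have [[dh [cR cI]] vh] := C1_path_horner p Ch.
- exists (Re_path (fun t => p.[h t])); first by split => [t|//]; case: (dh t).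
  split => t tj; first by rewrite /Re_path gh.
  rewrite (velocity_oo gh tj) gh; last by case/andP: tj => /ltW -> /ltW ->.
  by move/(congr1 (fun v => complex.Re (v t))): vh => /= ->.
- exists (Im_path (fun t => p.[h t])); first by split => [t|//]; case: (dh t).
  split => t tj; first by rewrite /Im_path gh.
  rewrite (velocity_oo gh tj) gh; last by case/andP: tj => /ltW -> /ltW ->.
  by move/(congr1 (fun v => complex.Im (v t))): vh => /= ->.
Qed.

Lemma poly_primitive p : exists q : {poly C}, q^`() = p.
Proof.
(* At index 0 the division by zero returns 0, so this primitive has no constant term. *)
exists (\poly_(i < (size p).+1) (p`_i.-1 / i%:R)).
apply/polyP => i; rewrite coef_deriv coef_poly /= ltnS.
case: ltnP => ip; first by rewrite -(mulr_natr (_ / _)) divfK ?pnatr_eq0.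
by rewrite mul0rn nth_default.
Qed.

Lemma closed_contour_integral_poly g p : piecewise_C1 g -> g 0 = g 1 ->
  contour_integral g (fun z => p.[z]) = 0.
Proof.
move=> pg g01; have [q <-] := poly_primitive p.
by rewrite contour_integral_deriv // g01 subrr.
Qed.

Lemma contour_integrable_poly g p : piecewise_C1 g ->
  contour_integrable g (fun z => p.[z]).
Proof.
move=> pg; apply: contour_integrable_continuous => // h t _ _.
exact: ccontinuous_horner.
Qed.

Lemma contour_integrable_pole g a : piecewise_C1 g -> ~ on_curve g a ->
  contour_integrable g (fun z => (z - a)^-1).
Proof.
move=> pg ga; apply: contour_integrable_continuous => // h t t01 ght ch.
apply: ccontinuousV; first by apply: ccontinuousD => //; exact: ccontinuous_cst.
by rewrite -ght subr_eq0; apply/eqP => gta; apply: ga; exists t.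
Qed.

Lemma two_pi_i_neq0 : two_pi_i R != 0.
Proof.
rewrite eq_complex /= negb_and mulf_neq0 ?orbT //.
by rewrite gt_eqF // pi_gt0.
Qed.

Lemma contour_integral_pole g a :
  contour_integral g (fun z => (z - a)^-1) = two_pi_i R * winding g a.
Proof. by rewrite /winding mulrA divff ?mul1r // two_pi_i_neq0. Qed.

End ContourIntegral.

(** * Divided differences *)

Section DividedDifference.
Variable F : fieldType.
Implicit Types (s : seq F) (p q : {poly F}) (a b c : F).

Definition nodal s : {poly F} := \prod_(a <- s) ('X - a%:P).

(** The divided difference of [p] at the nodes [s], in its symmetric form; for distinct nodes it is
    also the sum of the residues of p / [nodal s]. *)
Definition ddiff s p : F :=
  \sum_(a <- s) p.[a] / \prod_(b <- s | b != a) (a - b).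

Lemma horner_nodal s c : (nodal s).[c] = \prod_(a <- s) (c - a).
Proof.
by rewrite /nodal horner_prod; apply: eq_bigr => a _; rewrite hornerXsubC.
Qed.

Lemma monic_nodal s : nodal s \is monic.
Proof. exact: monic_prod_XsubC. Qed.

Lemma size_nodal s : size (nodal s) = (size s).+1.
Proof. exact: size_prod_XsubC. Qed.

Lemma prod_subr_neq0 s a : \prod_(b <- s | b != a) (a - b) != 0.
Proof. rewrite prodf_seq_neq0; apply/allP => b _; apply/implyP => ba.
by rewrite subr_eq0 eq_sym. Qed.

Definition lagrange s p : {poly F} :=
  \sum_(a <- s) (p.[a] / \prod_(b <- s | b != a) (a - b)) *:
    \prod_(b <- s | b != a) ('X - b%:P).

(** The interpolant agrees with [p] at every node, so the difference has all the nodes as roots. *)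
Lemma lagrange_eq s p : uniq s -> exists q, p = lagrange s p + q * nodal s.
Proof.
move=> us; suff /dvdpP[q Eq] : nodal s %| p - lagrange s p.
  by exists q; rewrite -Eq addrC subrK.
apply: uniq_roots_dvdp; last by rewrite uniq_rootsE.
apply/allP => a sa; rewrite rootE hornerD hornerN subr_eq0 horner_sum.
rewrite (bigD1_seq a) //= [X in _ + X]big1_seq => [|c /andP[ca _]].
  rewrite addr0 hornerZ horner_prod.
  under [X in _ * X]eq_bigr do rewrite hornerXsubC.
  by rewrite divfK // prod_subr_neq0.
rewrite hornerZ horner_prod (_ : \prod_(b <- s | b != c) _ = 0) ?mulr0 //.
apply/eqP; rewrite prodf_seq_eq0; apply/hasP; exists a => //.
by rewrite eq_sym ca hornerXsubC subrr /=.
Qed.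

Lemma nodal_neq s a : uniq s -> a \in s ->
  \prod_(b <- s | b != a) ('X - b%:P) = nodal (rem a s).
Proof.
by move=> us sa; rewrite /nodal rem_filter // big_filter.
Qed.

Lemma size_lagrange s p : uniq s -> (size (lagrange s p) <= size s)%N.
Proof.
move=> us; rewrite /lagrange big_seq.
apply: (big_ind (fun q => size q <= size s)%N); first by rewrite size_poly0.
  by move=> p1 p2 h1 h2; rewrite (leq_trans (size_polyD _ _)) // geq_max h1.
move=> a sa; apply: leq_trans (size_scale_leq _ _) _.
rewrite nodal_neq // size_nodal size_rem //.
by case: s sa us.
Qed.

Lemma coef_lagrange s p : uniq s -> (lagrange s p)`_(size s).-1 = ddiff s p.
Proof.
move=> us; rewrite /lagrange coef_sum big_seq [RHS]big_seq.
apply: eq_bigr => a sa; rewrite coefZ nodal_neq //.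
have := monicP (monic_nodal (rem a s)).
by rewrite lead_coefE size_nodal size_rem // => ->; rewrite mulr1.
Qed.

(** A polynomial of degree below the number of nodes is its own interpolant, as a nonzero multiple
    of [nodal s] would be too large. *)
Lemma ddiff_small s p : uniq s -> (size p <= size s)%N ->
  ddiff s p = p`_(size s).-1.
Proof.
move=> us sp; rewrite -coef_lagrange //; congr (_`__).
have [q Eq] := lagrange_eq p us.
have [q0|q0] := eqVneq q 0; first by rewrite {2}Eq q0 mul0r addr0.
have : (size (q * nodal s)%R <= size s)%N.
  have -> : q * nodal s = p - lagrange s p.
    by apply/eqP; rewrite eq_sym subr_eq addrC -Eq.
  rewrite (leq_trans (size_polyD _ _)) // geq_max sp size_polyN.
  exact: size_lagrange.
rewrite size_Mmonic ?monic_nodal // size_nodal addnS /=.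
rewrite -[X in (_ <= X)%N]add0n leq_add2r leqn0 size_poly_eq0.
by rewrite (negPf q0).
Qed.

Lemma ddiffD s p q : ddiff s (p + q) = ddiff s p + ddiff s q.
Proof. by rewrite /ddiff -big_split; apply: eq_bigr => a _; rewrite hornerD mulrDl. Qed.

Lemma ddiffZ s c p : ddiff s (c *: p) = c * ddiff s p.
Proof.
by rewrite /ddiff mulr_sumr; apply: eq_bigr => a _; rewrite hornerZ mulrA.
Qed.

Lemma ddiff_mul_prod s p q : ddiff s (p + q * nodal s) = ddiff s p.
Proof.
rewrite /ddiff big_seq [RHS]big_seq; apply: eq_bigr => a sa.
rewrite hornerD hornerM horner_nodal (_ : \prod_(b <- s) (a - b) = 0).
  by rewrite mulr0 addr0.
by apply/eqP; rewrite prodf_seq_eq0; apply/hasP; exists a; rewrite ?subrr /=.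
Qed.

Lemma ddiff_cons_mul s a p : a \notin s -> ddiff (a :: s) (p * nodal s) = p.[a].
Proof.
move=> sa; rewrite /ddiff big_cons [X in _ + X]big1_seq ?addr0; last first.
  move=> b /andP[_ sb]; rewrite hornerM horner_nodal.
  rewrite (_ : \prod_(c <- s) (b - c) = 0) ?mulr0 ?mul0r //.
  by apply/eqP; rewrite prodf_seq_eq0; apply/hasP; exists b; rewrite ?subrr /=.
rewrite hornerM horner_nodal big_cons eqxx /=.
rewrite [in X in _ / X]big_seq_cond; under [in X in _ / X]eq_bigl => b.
  rewrite (_ : _ && _ = (b \in s)); last first.
    by case sb: (b \in s) => //=; apply: contraNneq sa => <-.
  over.
rewrite -big_seq mulfK // prodf_seq_neq0; apply/allP => b sb /=.
by rewrite subr_eq0; apply: contraNneq sa => ->.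
Qed.

(** In the Euclidean division by [nodal s], the multiple of [nodal s] contributes only at [a], and
    the remainder has too low a degree to contribute. This evaluates the w integral, with [a] the
    point z and [s] the zeros of the Pochhammer symbol in w. *)
Lemma ddiff_divp s a p : uniq s -> a \notin s ->
  ddiff (a :: s) p = (p %/ nodal s).[a].
Proof.
move=> us sa; have s0 : nodal s != 0 by rewrite monic_neq0 ?monic_nodal.
have sm : (size (p %% nodal s)%R <= size s)%N.
  by rewrite -ltnS -(size_nodal s) ltn_modp.
rewrite {1}(divp_eq p (nodal s)) ddiffD ddiff_cons_mul //.
rewrite ddiff_small /= ?sa //; last exact: leqW.
by rewrite nth_default // addr0.
Qed.

Lemma coefM_top p q (m n : nat) : (size p <= m.+1)%N -> (size q <= n.+1)%N ->
  (p * q)`_(m + n) = p`_m * q`_n.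
Proof.
move=> pm qn; have lt_m : (m < (m + n).+1)%N by rewrite ltnS leq_addr.
rewrite coefM (bigD1 (Ordinal lt_m)) //= addKn big1 ?addr0 // => i.
rewrite -val_eqE /= neq_ltn => /orP[im|mi].
  rewrite [q`__]nth_default ?mulr0 // (leq_trans qn) //.
  by rewrite ltn_subRL ltn_add2r.
by rewrite [p`__]nth_default ?mul0r // (leq_trans pm).
Qed.

(* As [nodal s %/ nodal r] is monic, only the leading coefficient of
   [q %% nodal r] survives on the left. *)
Lemma ddiff_mul_divp s r q : uniq s -> uniq r ->
  (0 < size r <= size s)%N -> (size q <= size s)%N ->
  ddiff s (q * (nodal s %/ nodal r)) = ddiff r q.
Proof.
move=> us ur /andP[r_gt0 rs] qs.
set L := nodal s; set D := nodal r; set P := L %/ D.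
have D0 : D != 0 by rewrite monic_neq0 ?monic_nodal.
set U := q %/ D; set V := q %% D; set W := L %% D.
have sV : (size V <= size r)%N by rewrite /V -ltnS -(size_nodal r) ltn_modp.
have sW : (size W <= size r)%N by rewrite /W -ltnS -(size_nodal r) ltn_modp.
have sD : size D = (size r).+1 := size_nodal r.
have sP : size P = (size s - size r).+1.
  by rewrite size_divp // !size_nodal subSn.
have lP : lead_coef P = 1.
  have := divp_eq L D; rewrite -/P -/W => LE.
  have := monicP (monic_nodal s); rewrite -/L LE lead_coefDl.
    by rewrite lead_coef_Mmonic ?monic_nodal.
  rewrite size_Mmonic ?monic_nodal -?size_poly_gt0 ?sP //.
  by rewrite sD addSnnS addnS /= addnS ltnS (leq_trans sW) // leq_addl.
(* From q = U D + V and P D = L - W; the multiple of [L] vanishes at all nodes of [s]. *)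
have -> : q * P = V * P - U * W + U * L.
  have -> : q = U * D + V := divp_eq q D.
  have -> : L = P * D + W := divp_eq L D.
  ring.
rewrite ddiff_mul_prod.
have sU : (size U <= size s - size r)%N.
  rewrite size_divp // size_nodal /=; exact: leq_sub2r.
have sVP : (size (V * P)%R <= size s)%N.
  apply: leq_trans (size_polyMleq _ _) _; rewrite sP addnS /=.
  by rewrite -[leqRHS](subnKC rs) leq_add2r.
have sUW : (size (U * W)%R <= (size s).-1)%N.
  apply: leq_trans (size_polyMleq _ _) _.
  by rewrite -!subn1 leq_sub2r // -[leqRHS](subnK rs) leq_add.
rewrite ddiff_small //; last first.
  rewrite (leq_trans (size_polyD _ _)) // geq_max sVP size_polyN.
  by rewrite (leq_trans sUW) ?leq_pred.
rewrite coefB (nth_default _ sUW) subr0.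
rewrite [in RHS](divp_eq q D) addrC ddiff_mul_prod ddiff_small //.
have -> : (size s).-1 = ((size r).-1 + (size s - size r))%N.
  by rewrite -[in LHS](subnKC rs) -(prednK r_gt0) addSn.
rewrite coefM_top ?prednK ?sP // -[RHS]mulr1; congr (_ * _).
by rewrite -lP lead_coefE sP.
Qed.

(** A factor X - c in the polynomial removes the node c; the recurrence then comes from (X - b) - (X
    - a) = a - b. *)
Lemma ddiff_rec (a b : F) s p : uniq (a :: rcons s b) ->
  ddiff (a :: rcons s b) p * (a - b) = ddiff (a :: s) p - ddiff (rcons s b) p.
Proof.
move=> us.
have H c s1 s2 : perm_eq (c :: s2) s1 -> uniq s1 ->
    ddiff s1 (p * ('X - c%:P)) = ddiff s2 p.
  move=> cs us1; rewrite /ddiff -(perm_big _ cs) big_cons /=.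
  rewrite hornerM hornerXsubC subrr mulr0 mul0r add0r.
  have ucr : uniq (c :: s2) by rewrite (perm_uniq cs).
  rewrite big_seq [RHS]big_seq; apply: eq_bigr => d dr.
  have dc : d != c by apply: contraTneq dr => ->; case/andP: ucr.
  rewrite -(perm_big _ cs) big_cons eq_sym dc /= hornerM hornerXsubC.
  by rewrite invfM mulrA mulfK // subr_eq0.
have p1 : perm_eq (b :: a :: s) (a :: rcons s b).
  by rewrite -cats1 -(perm_rot 1) /= rot1_cons -cats1.
rewrite -(H b _ _ p1 us) -(H a _ (rcons s b) (perm_refl _) us).
rewrite -[- ddiff _ _]mulN1r -ddiffZ -ddiffD mulrC -ddiffZ; congr ddiff.
rewrite scaleN1r -mul_polyC polyCB; ring.
Qed.

End DividedDifference.

(** * The kernel as a finite sum *)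

Section LatticeKernel.
Variable F : numFieldType.
Implicit Types (z : F) (d x y : int) (j m n N M : nat) (L : seq int).

(** The binomial coefficient C(z + j - 1, j - 1) as a polynomial in z. For j > 0 the index is one
    more than the degree, so that Pascal's rule lowers it down to the zero function at j = 0. *)
Definition binr j z : F :=
  if j is k.+1 then \prod_(0 <= i < k) (z + 1 + i%:R) / k`!%:R else 0.

Lemma binr_pascal j z : binr j.+1 z - binr j.+1 (z - 1) = binr j z.
Proof.
case: j => [|k]; first by rewrite /= !big_nil subrr.
rewrite /binr -mulrBl factS natrM invfM mulrA; congr (_ / _).
have -> : \prod_(0 <= i < k.+1) (z - 1 + 1 + i%:R) =
    z * \prod_(0 <= i < k) (z + 1 + i%:R).
  rewrite big_nat_recl // addr0 subrK; congr (_ * _).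
  by apply: eq_bigr => i _; rewrite -nat1r; ring.
rewrite big_nat_recr //= [z * _]mulrC -mulrBr -mulrA.
rewrite (_ : z + 1 + k%:R - z = k.+1%:R); last by rewrite -nat1r; ring.
by rewrite divff ?mulr1 // pnatr_eq0.
Qed.

Lemma binr0 j : binr j.+1 0 = 1.
Proof.
rewrite /binr (_ : \prod_(_ <= _ < _) _ = j`!%:R) ?divff ?pnatr_eq0 -?lt0n ?fact_gt0 //.
elim: j => [|j IH]; first by rewrite big_nil.
by rewrite big_nat_recr //= IH factS mulnC natrM add0r nat1r.
Qed.

Lemma binr_eq0 j d : - j%:Z < d < 0 -> binr j d%:~R = 0.
Proof.
case: j => [//|k] dk; rewrite /binr.
rewrite (_ : \prod_(_ <= _ < _) _ = 0) ?mul0r //.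
apply/eqP; rewrite prodf_seq_eq0; apply/hasP; exists (absz d).-1.
  by rewrite mem_index_iota; lia.
rewrite /= -[_%:R]/((absz d).-1%:Z%:~R) -[1]/(1%:~R) -!rmorphD intr_eq0.
lia.
Qed.

(** With truncated subtraction, [phi (n - m)] is zero for n <= m and so contains the indicator of m
    < n in the kernel. *)
Definition phi j d : F := if 0 <= d then binr j d%:~R else 0.

Lemma phi_binr j d : - j%:Z < d -> phi j d = binr j d%:~R.
Proof. by rewrite /phi; case: ifPn => // d0 jd; rewrite binr_eq0 // jd ltNge. Qed.

(** Pascal's rule survives the cut-off except at j = 0: there [phi 1] is the unit step and its
    difference is the delta at 0. *)
Lemma phi_rec j d :
  phi j.+1 d - phi j.+1 (d - 1) = if j is 0%N then (d == 0)%:R else phi j d.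
Proof.
have [d0|d0|->] := ltgtP d 0.
- rewrite /phi ifF; last lia.
  rewrite ifF; last lia.
  by rewrite subrr; case: j => [|j]; rewrite ?lt_eqF // ifF //; lia.
- rewrite {1 2}/phi ifT; last lia.
  rewrite ifT; last lia.
  rewrite rmorphB binr_pascal; case: j => [|j]; first by [].
  by rewrite /phi ifT //; lia.
- rewrite {1 2}/phi.
  rewrite mulr0z binr0 subr0; case: j => [|j]; first by [].
  by rewrite /phi lexx mulr0z binr0.
Qed.

Definition binr_poly j y : {poly F} :=
  if j is k.+1 then
    (k`!%:R)^-1 *: \prod_(0 <= i < k) ('X - (y - 1 - i%:Z)%:~R%:P)
  else 0.

Lemma horner_binr_poly j y z : (binr_poly j y).[z] = binr j (z - y%:~R).
Proof.
case: j => [|k]; first by rewrite horner0.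
rewrite /binr_poly /binr hornerZ mulrC horner_prod; congr (_ / _).
apply: eq_bigr => i _; rewrite hornerXsubC !rmorphB /=.
rewrite -[i%:Z%:~R]/(i%:R : F); ring.
Qed.

Lemma size_binr_poly j y : (size (binr_poly j y) <= j)%N.
Proof.
case: j => [|k]; first by rewrite size_poly0.
apply: leq_trans (size_scale_leq _ _) _.
by rewrite size_prod_XsubC size_iota subn0.
Qed.

(** The zeros in w of the Pochhammer symbol (w - x)_(M+1). *)
Definition column x M : seq F := [seq (x - i%:Z)%:~R | i <- iota 0 M.+1].

Lemma size_column x M : size (column x M) = M.+1.
Proof. by rewrite size_map size_iota. Qed.

Lemma uniq_column x M : uniq (column x M).
Proof.
rewrite map_inj_uniq ?iota_uniq // => i j /intr_inj; lia.
Qed.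

Lemma mem_column x M (a : F) :
  a \in column x M -> exists2 i : nat, (i <= M)%N & a = (x - i%:Z)%:~R.
Proof. by move=> /mapP[j]; rewrite mem_iota ltnS => jM ->; exists j. Qed.

(** At consecutive integers a divided difference is an iterated backward difference over M!, and
    each difference lowers the index of [binr] by Pascal's rule. Once the truncated index j - M
    reaches 0, all further differences are zero, as is [binr 0]. *)
Lemma ddiff_column_binr j y x M :
  M`!%:R * ddiff (column x M) (binr_poly j y) = binr (j - M) (x - y)%:~R.
Proof.
elim: M x => [|M IH] x.
  rewrite mul1r /ddiff big_seq1 big_cons big_nil eqxx subr0 divr1 horner_binr_poly.
  by rewrite subn0 rmorphB.
set s := [seq (x - i%:Z)%:~R | i <- iota 1 M] : seq F.
set b := (x - M.+1%:Z)%:~R : F.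
have E1 : column x M = x%:~R :: s by rewrite /column /= subr0.
have E4 : column (x - 1) M = [seq (x - i%:Z)%:~R | i <- iota 1 M.+1].
  rewrite (iotaDl 1 0) -map_comp; apply: eq_map => i /=.
  by congr (_%:~R); lia.
have E2 : column (x - 1) M = rcons s b.
  by rewrite E4 -[M.+1]addn1 iotaD map_cat /= add1n cats1.
have E3 : column x M.+1 = x%:~R :: rcons s b.
  by rewrite -E2 E4 /column /= subr0.
have us : uniq (x%:~R :: rcons s b) by rewrite -E3 uniq_column.
have := ddiff_rec (binr_poly j y) us.
rewrite -E3 -E1 -E2.
rewrite (_ : x%:~R - b = M.+1%:R); last first.
  by rewrite /b -rmorphB /= opprB addrC subrK.
move=> H; rewrite factS natrM mulrC mulrA H mulrC mulrBr !IH.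
rewrite (_ : (x - 1 - y)%:~R = (x - y)%:~R - 1); last first.
  by rewrite !rmorphB addrAC.
case E: (j - M)%N => [|k]; first by rewrite subrr subnS E.
by rewrite binr_pascal subnS E.
Qed.

(* [L] lists the positions [nu r - r] of the particles of the top row. *)
Definition top_poly L : {poly F} := nodal [seq p%:~R | p <- L].

(** For a particle p, the residue at z = p of P / Pi, where P is the polynomial quotient of Pi by
    the column product. *)
Definition residue_factor L N x n (p : int) : F :=
  (top_poly L %/ nodal (column x (N - n))).[p%:~R] /
    \prod_(q <- L | q != p) (p - q)%:~R.

Definition lattice_kernel L N x n y m : F :=
  - phi (n - m) (x - y) +
  (N - n)`!%:R * \sum_(p <- L) phi (N - m) (p - y) * residue_factor L N x n p.

(** Pascal's rule is applied to both terms in the second pair of variables. The delta comes from the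
    first term at n' = n. In the sum a delta could arise only at n' = N, and would need a particle
    at x'. The value 0 at n' = N reflects that no black site lies on level N. *)
Lemma lattice_kernel_rec L N x n x' n' :
  (n' <= N)%N -> (n <= N)%N -> (0 < n')%N -> (n' = N -> x' \notin L) ->
  (if n' == N then 0 else lattice_kernel L N x n x' n')
  - lattice_kernel L N x n x' n'.-1 + lattice_kernel L N x n (x' + 1) n'.-1 =
  ((x' == x) && (n' == n))%:R.
Proof.
move=> n'N nN n'0 x'L.
have S d : phi (N - n'.-1) d - phi (N - n'.-1) (d - 1) =
    if n' == N then (d == 0)%:R else phi (N - n') d.
  rewrite (_ : (N - n'.-1 = (N - n').+1)%N); last lia.
  rewrite phi_rec; case: (eqVneq n' N) => [->|nn]; first by rewrite subnn.
  by case E: (N - n')%N => //; lia.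
have Esum : \sum_(p <- L) phi (N - n'.-1) (p - x') * residue_factor L N x n p =
    (if n' == N then 0 else
      \sum_(p <- L) phi (N - n') (p - x') * residue_factor L N x n p) +
    \sum_(p <- L) phi (N - n'.-1) (p - (x' + 1)) * residue_factor L N x n p.
  have -> : (if n' == N then 0 else
      \sum_(p <- L) phi (N - n') (p - x') * residue_factor L N x n p) =
      \sum_(p <- L) (if n' == N then 0
        else phi (N - n') (p - x') * residue_factor L N x n p).
    by case: ifP => // _; rewrite big1.
  rewrite -big_split /= big_seq [RHS]big_seq; apply: eq_bigr => p pL.
  apply/eqP; rewrite -subr_eq -mulrBl opprD addrA S; apply/eqP.
  case: (eqVneq n' N) => // /x'L {}x'L.
  rewrite subr_eq0 (_ : (p == x') = false) ?mul0r //.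
  by apply: contraNF x'L => /eqP <-.
have Ephi : phi (n - n'.-1) (x - x') =
    phi (n - n') (x - x') + ((x' == x) && (n' == n))%:R +
    phi (n - n'.-1) (x - (x' + 1)).
  have [nn|nn] := leqP n' n; last first.
    rewrite (_ : (n - n'.-1 = 0)%N); last lia.
    rewrite (_ : (n - n' = 0)%N); last lia.
    rewrite (gtn_eqF nn) andbF /phi /=.
    by do 3?case: ifP; rewrite !addr0.
  rewrite (_ : (n - n'.-1 = (n - n').+1)%N); last lia.
  apply/eqP; rewrite -subr_eq opprD addrA phi_rec; apply/eqP.
  case E : (n - n')%N => [|k].
    rewrite (_ : n' = n) ?eqxx ?andbT; last lia.
    by rewrite subr_eq0 eq_sym /phi /=; case: ifP; rewrite add0r.
  by rewrite (_ : (n' == n) = false) ?andbF ?addr0 //; lia.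
have a1 : n' == N -> phi (n - n') (x - x') = 0.
  move=> /eqP ->; rewrite (_ : (n - N = 0)%N) /phi; last lia.
  by case: ifP.
rewrite /lattice_kernel Esum Ephi.
case: (eqVneq n' N) a1 => [_ /(_ isT) ->|_ _]; ring.
Qed.

Lemma lattice_kernel_right L N x n y m :
  (forall p, p \in L -> p < y) -> x < y -> lattice_kernel L N x n y m = 0.
Proof.
move=> Ly xy; rewrite /lattice_kernel {1}/phi ifF; last lia.
rewrite oppr0 add0r big_seq big1 ?mulr0 // => p /Ly py.
by rewrite /phi ifF ?mul0r //; lia.
Qed.

(* On the left boundary the indicator [y <= p] can be dropped from the sum,
   which then is a divided difference over all of [L]. *)
Lemma lattice_kernel_left L N x n y m (a : int) :
  uniq L -> size L = N -> (forall p, p \in L -> a <= p) ->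
  (0 < n <= N)%N -> (m < N)%N ->
  a + (N%:Z - n%:Z) <= x -> y = a + N%:Z - m%:Z - 1 ->
  lattice_kernel L N x n y m = 0.
Proof.
move=> uL sL aL /andP[n0 nN] mN ax Ey.
rewrite /lattice_kernel.
have -> : \sum_(p <- L) phi (N - m) (p - y) * residue_factor L N x n p =
    ddiff [seq p%:~R | p <- L] (binr_poly (N - m) y *
      (top_poly L %/ nodal (column x (N - n)))).
  rewrite /ddiff big_map big_seq [RHS]big_seq; apply: eq_bigr => p pL.
  (* The bound a <= p gives p - y > -(N - m), where [phi] and [binr] agree. *)
  rewrite /residue_factor hornerM horner_binr_poly mulrA phi_binr; last first.
    by have := aL p pL; lia.
  rewrite rmorphB; congr (_ / _).
  rewrite big_map; apply: eq_big => [q|q _]; last by rewrite rmorphB.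
  by rewrite (inj_eq intr_inj).
rewrite ddiff_mul_divp ?uniq_column //; first last.
- by rewrite size_map sL (leq_trans (size_binr_poly _ _)) // leq_subr.
- by rewrite size_column size_map sL; lia.
- by rewrite map_inj_uniq //; exact: intr_inj.
rewrite ddiff_column_binr (_ : (N - m - (N - n) = n - m)%N); last lia.
(* For m < n the bound on x gives x - y > -(n - m), so the first term loses its cut-off too and
   cancels; otherwise both indices are 0. *)
have [mn|nm] := ltnP m n; first by rewrite phi_binr ?addNr //; lia.
rewrite (_ : (n - m = 0)%N); last lia.
by rewrite /phi /=; case: ifP; rewrite addr0 oppr0.
Qed.

End LatticeKernel.

(** * Evaluation of the two contour integrals by residues *)

Section Residues.
Variable R : realType.
Local Notation C := R[i].
Implicit Types (g gz gw : R -> C) (a z : C) (s : seq C).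

(** Partial fractions: Lagrange interpolation splits the integrand into a polynomial, whose integral
    is 0, and simple poles, each weighted by its winding number. *)
Lemma contour_integral_residues g s (p : {poly C}) : piecewise_C1 g -> g 0 = g 1 ->
  uniq s -> (forall a, a \in s -> ~ on_curve g a) ->
  contour_integral g (fun z => p.[z] / \prod_(a <- s) (z - a)) =
  two_pi_i R * \sum_(a <- s)
    winding g a * (p.[a] / \prod_(b <- s | b != a) (a - b)).
Proof.
move=> pg g01 us gs; have [q Eq] := lagrange_eq p us.
pose c a := p.[a] / \prod_(b <- s | b != a) (a - b).
have cP a : a \in s -> contour_integrable g (fun z => c a * (z - a)^-1).
  by move=> sa; apply/contour_integrableZ/contour_integrable_pole/gs.
have [iS eS] := contour_integral_sum cP.
transitivity (contour_integral g
    (fun z => q.[z] + \sum_(a <- s) c a * (z - a)^-1)).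
  apply: eq_contour_integral => t t01.
  have nz a : a \in s -> g t - a != 0.
    by move=> sa; rewrite subr_eq0; apply/eqP => gta; apply: (gs a sa); exists t.
  have nzp : \prod_(a <- s) (g t - a) != 0.
    by rewrite prodf_seq_neq0; apply/allP => a /nz.
  rewrite {1}Eq hornerD hornerM horner_nodal addrC mulrDl mulfK //.
  congr (_ + _); rewrite /lagrange horner_sum mulr_suml big_seq [RHS]big_seq.
  apply: eq_bigr => a sa; rewrite hornerZ horner_prod -mulrA; congr (_ * _).
  under eq_bigr do rewrite hornerXsubC.
  rewrite (bigD1_seq a) //= invfM mulrC mulfVK //.
  by rewrite prodf_seq_neq0; apply/allP => b sb; apply/implyP => _; exact: nz.
rewrite contour_integralD //; last exact: contour_integrable_poly.
rewrite closed_contour_integral_poly // add0r eS mulr_sumr big_seq [RHS]big_seq.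
apply: eq_bigr => a sa; rewrite contour_integralZ; last first.
  exact/contour_integrable_pole/gs.
by rewrite contour_integral_pole mulrCA [c a * _]mulrC.
Qed.

Lemma contour_integral_enclosed g s (p : {poly C}) : piecewise_C1 g -> g 0 = g 1 ->
  uniq s -> (forall a, a \in s -> encloses g a) ->
  contour_integral g (fun z => p.[z] / \prod_(a <- s) (z - a)) =
  two_pi_i R * ddiff s p.
Proof.
move=> pg g01 us gs; rewrite contour_integral_residues //; last first.
  by move=> a /gs[].
congr (_ * _); rewrite /ddiff big_seq [RHS]big_seq; apply: eq_bigr => a sa.
by have [_ ->] := gs a sa; rewrite mul1r.
Qed.

Lemma pochhammer_column (w : C) (x : int) (M : nat) :
  pochhammer (w - x%:~R) M.+1 = \prod_(a <- column _ x M) (w - a).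
Proof.
rewrite /pochhammer /column big_map; apply: eq_bigr => j _.
by rewrite rmorphB opprB addrCA addrC.
Qed.

Lemma pochhammer_binr (z : C) (y : int) (j : nat) :
  pochhammer (z - y%:~R + 1) j = j`!%:R * (binr_poly C j.+1 y).[z].
Proof.
rewrite horner_binr_poly /binr mulrC divfK; first by [].
by rewrite pnatr_eq0 -lt0n fact_gt0.
Qed.

Definition top_positions (nu : nat -> int) (N : nat) : seq int :=
  [seq nu r - r%:Z | r <- index_iota 1 N.+1].

Lemma prod_top_positions (w : C) nu N :
  \prod_(1 <= r < N.+1) (w + r%:R - (nu r)%:~R) = (top_poly C (top_positions nu N)).[w].
Proof.
rewrite /top_poly horner_nodal /top_positions !big_map.
by apply: eq_bigr => r _; rewrite rmorphB /= -[r%:Z%:~R]/(r%:R : C); ring.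
Qed.

(** The w integral is done first, at each point of the z contour. The bounds on x keep the whole
    column among the integers that the z contour encloses or excludes, so z never meets it. *)
Lemma corr_kernel_lattice N nu gz gw (x y : int) (n m : nat) :
  uniq (top_positions nu N) ->
  (forall r, (1 <= r <= N)%N -> nu N - N%:Z <= nu r - r%:Z <= nu 1%N - 1) ->
  (0 < n <= N)%N -> (m < N)%N ->
  nu N - N%:Z <= x - (N%:Z - n%:Z) -> x <= nu 1%N - 1 ->
  z_contour N nu gz y -> w_contour N gw gz x n ->
  corr_kernel N nu gz gw x n y m = lattice_kernel C (top_positions nu N) N x n y m.
Proof.
move=> uL rangeL /andP[n0 nN] mN xl xr [ccz z_in z_out] [ccw w_z w_x].
have [pz gz01 _ _] := ccz; have [pw gw01 _ _] := ccw.
set L := top_positions nu N; set M := (N - n)%N; set k := (N - m.+1)%N.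
have Lrange (p : int) : p \in L -> nu N - N%:Z <= p <= nu 1%N - 1.
  by move=> /mapP[r]; rewrite mem_index_iota => rN ->; apply: rangeL.
have offz (p : int) : nu N - N%:Z <= p <= nu 1%N - 1 -> ~ on_curve gz p%:~R.
  by move=> /andP[p1 p2]; have [yp|py] := lerP y p;
    [case: (z_in p)|case: (z_out p)] => //; lia.
set D := column C x M.
have uD : uniq D := uniq_column C x M.
have Dw a : a \in D -> encloses gw a.
  move=> /mem_column[j jM ->]; apply: w_x; lia.
have Dz t a : 0 <= t <= 1 -> a \in D -> gz t != a.
  move=> t01 /mem_column[j jM ->]; apply/eqP => gt.
  by apply: (offz (x - j%:Z)); [lia|exists t].
set P := top_poly C L %/ nodal D.
have inner t : 0 <= t <= 1 ->
    contour_integral gw (fun w => pochhammer (gz t - y%:~R + 1) k /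
        pochhammer (w - x%:~R) M.+1 * (w - gz t)^-1 *
        \prod_(1 <= r < N.+1) ((w + r%:R - (nu r)%:~R) /
           (gz t + r%:R - (nu r)%:~R))) =
    (two_pi_i R *: (k`!%:R *: (binr_poly C k.+1 y * P))).[gz t] /
    \prod_(a <- [seq p%:~R | p <- L]) (gz t - a).
  move=> t01; set c := pochhammer (gz t - y%:~R + 1) k / (top_poly C L).[gz t].
  (* The point z joins the column as a simple pole, and all these poles are enclosed. *)
  transitivity (contour_integral gw (fun w => (c *: top_poly C L).[w] /
      \prod_(a <- gz t :: D) (w - a))).
    apply: eq_contour_integral => u u01.
    rewrite pochhammer_column big_split /= prodfV !prod_top_positions.
    rewrite big_cons invfM hornerZ /c; ring.
  rewrite contour_integral_enclosed //; last 2 first.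
  - by rewrite cons_uniq uD andbT; apply/negP => /(Dz t _ t01); rewrite eqxx.
  - by move=> a; rewrite inE => /orP[/eqP ->|/Dw //]; exact: w_z.
  rewrite ddiff_divp //; last first.
    by apply/negP => /(Dz t _ t01); rewrite eqxx.
  rewrite divpZl hornerZ -/P !hornerZ hornerM /c pochhammer_binr /top_poly.
  by rewrite horner_nodal; ring.
rewrite /corr_kernel /lattice_kernel; congr (_ + _).
  congr (- _); rewrite /phi.
  have [mn|nm] := ltnP m n; last first.
    rewrite (_ : (n - m = 0)%N) /=; last lia.
    by rewrite ifF; [case: ifP|lia].
  rewrite (_ : m%:Z < n%:Z) //= subr_ge0.
  rewrite (_ : absz (n%:Z - m%:Z - 1)%R = (n - m.+1)%N); last lia.
  rewrite (_ : (n - m = (n - m.+1).+1)%N); last lia.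
  case: ifP => // _; rewrite /binr /pochhammer.
  by congr (_ / _); apply: eq_bigr => j _; rewrite rmorphD.
rewrite (_ : absz (N%:Z - n%:Z)%R = M); last lia.
rewrite (_ : absz (N%:Z - m%:Z - 1)%R = k); last lia.
rewrite (_ : absz (N%:Z - n%:Z + 1)%R = M.+1); last lia.
have -> : (N - m = k.+1)%N by rewrite /k; lia.
have uLC : uniq ([seq p%:~R | p <- L] : seq C).
  by rewrite map_inj_uniq //; exact: intr_inj.
rewrite (eq_contour_integral (f2 := fun z =>
    (two_pi_i R *: (k`!%:R *: (binr_poly C k.+1 y * P))).[z] /
    \prod_(a <- [seq p%:~R | p <- L]) (z - a))); last exact: inner.
rewrite contour_integral_residues //; last first.
  by move=> a /mapP[p /Lrange pL ->]; apply: offz.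
rewrite -!mulrA; congr (_ * _).
have pi0 := two_pi_i_neq0 R.
have k0 : k`!%:R != 0 :> C by rewrite pnatr_eq0 -lt0n fact_gt0.
rewrite big_map !mulr_sumr big_seq [RHS]big_seq; apply: eq_bigr => p pL.
rewrite !hornerZ hornerM horner_binr_poly /residue_factor -/D -/P.
(* The winding number is 1 for p >= y and 0 for p < y, which is the cut-off built into [phi]. *)
have -> : winding gz p%:~R * ((two_pi_i R * (k`!%:R * (binr k.+1 (p%:~R - y%:~R) *
     P.[p%:~R]))) / \prod_(b <- [seq p%:~R | p <- L] | b != p%:~R) (p%:~R - b)) =
   two_pi_i R * k`!%:R * (phi C k.+1 (p - y) * (P.[p%:~R] /
     \prod_(q <- L | q != p) (p - q)%:~R)).
  rewrite big_map.
  under eq_bigl do rewrite (inj_eq intr_inj).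
  under eq_bigr do rewrite -rmorphB.
  rewrite -rmorphB /phi subr_ge0; have [yp|py] := lerP y p.
    case: (z_in p) => [|_ ->]; last by ring.
    by have := Lrange p pL; lia.
  case: (z_out p) => [|_ ->]; first by have := Lrange p pL; lia.
  by rewrite !mul0r mulr0.
(* Each integral has produced one factor 2 pi i, and the Pochhammer symbol in z the factor (N - m -
   1)!; they cancel the prefactors. *)
by move: (phi _ _ _ * _) => e; field; rewrite k0 pi0.
Qed.

End Residues.

(** * Triangles contained in the polygon *)

Section Geometry.
Variable R : realType.
Implicit Types (S : set (R * R)) (p q u v w : R * R).

(** Moving a point of the closed triangle slightly towards the centroid makes all its barycentric
    coordinates positive. *)
Lemma triangle_sub_closure S u v w :
  (forall a b c : R, 0 < a -> 0 < b -> 0 < c -> a + b + c = 1 ->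
     S (a * u.1 + b * v.1 + c * w.1, a * u.2 + b * v.2 + c * w.2)) ->
  triangle u v w `<=` closure S.
Proof.
move=> int_S q [a [b [c [[a0 b0 c0] abc q1 q2]]]] V Vq.
pose d1 := 3^-1 * (u.1 + v.1 + w.1) - q.1; pose d2 := 3^-1 * (u.2 + v.2 + w.2) - q.2.
have cf : (fun e : R => (q.1 + e * d1, q.2 + e * d2)) @ (0 : R) -->
    (q.1 + 0 * d1, q.2 + 0 * d2).
  have lin (x d : R) : (fun e : R => x + e * d) @ (0 : R) --> x + 0 * d.
    apply: cvgD; first exact: cvg_cst.
    by apply: cvgM; [exact: cvg_id|exact: cvg_cst].
  exact: (@cvg_pair _ _ _ _ (nbhs (q.1 + 0 * d1)) (nbhs (q.2 + 0 * d2))).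
have Vq0 : nbhs (q.1 + 0 * d1, q.2 + 0 * d2) V.
  by rewrite !mul0r !addr0; case: (q) Vq.
have /nbhs_ballP[] := cf V Vq0.
(* Being below [r] keeps the moved point in the neighbourhood; being below 1 keeps the coordinates
   (1 - e) a + e / 3 positive. *)
move=> r /= r0 rV; set e := Num.min (r / 2) (1 / 2).
have e0 : 0 < e by rewrite lt_min !divr_gt0.
have er : e < r by rewrite gt_min ltr_pdivrMr // mulr_natr mulr2n ltrDl r0.
have e1 : e < 1 by rewrite gt_min; apply/orP; right; lra.
exists (q.1 + e * d1, q.2 + e * d2); split; last first.
  by apply: rV; rewrite -ball_normE /= sub0r normrN gtr0_norm.
have pos x : 0 <= x -> 0 < (1 - e) * x + e / 3.
  move=> x0; apply: ltr_wpDl; last by rewrite divr_gt0.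
  by rewrite mulr_ge0 // subr_ge0 ltW.
have := int_S _ _ _ (pos a a0) (pos b b0) (pos c c0).
have -> : (1 - e) * a + e / 3 + ((1 - e) * b + e / 3) + ((1 - e) * c + e / 3) =
    (1 - e) * (a + b + c) + e by field.
rewrite abc mulr1 subrK => /(_ erefl).
by congr S; rewrite /d1 /d2 q1 q2; congr (_, _); field.
Qed.

Lemma closure_le S (f : R * R -> R) (c : R) q : {for q, continuous f} ->
  (forall s, S s -> f s <= c) -> closure S q -> f q <= c.
Proof.
move=> cf Sc cS; rewrite leNgt; apply/negP => cq.
have [s [Ss /=]] := cS _ (cvgr_gt _ cf _ cq).
by rewrite ltNge Sc.
Qed.

Lemma continuous_fst q : {for q, continuous (fun s : R * R => s.1)}.
Proof. exact: cvg_fst. Qed.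

Lemma continuous_snd q : {for q, continuous (fun s : R * R => s.2)}.
Proof. exact: cvg_snd. Qed.

Lemma continuous_fst_snd q : {for q, continuous (fun s : R * R => s.1 + s.2)}.
Proof. by apply: cvgD; [exact: cvg_fst|exact: cvg_snd]. Qed.

Section Polygon.
Variables (k N : nat) (a b : nat -> int).
Local Notation A := (fun i => (a i)%:~R - 2^-1 : R).
Local Notation B := (fun i => (b i)%:~R - 2^-1 : R).

(** Weak inequalities pass to the closure. The last clause excludes only the interior of a removed
    region: that is an open condition, so it would also hold at some point of the set itself. *)
Lemma polygon_nec q : polygon k N A B q ->
  [/\ 0 <= q.2 <= N%:R, A 1%N + N%:R <= q.1 + q.2, q.1 <= B k &
      forall i, (1 <= i <= k)%N -> ~ (A i + N%:R < q.1 + q.2 /\ q.1 < B i)].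
Proof.
move=> Pq; split.
- apply/andP; split.
    rewrite -oppr_le0; apply: (closure_le (f := fun s => - s.2)) Pq.
      by apply: cvgN; exact: continuous_snd.
    by move=> s [/andP[s0 _] _ _]; rewrite oppr_le0 ltW.
  apply: (closure_le (f := fun s => s.2)) Pq; first exact: continuous_snd.
  by move=> s [/andP[_ sN] _ _]; rewrite ltW.
- rewrite -lerN2; apply: (closure_le (f := fun s => - (s.1 + s.2))) Pq.
    by apply: cvgN; exact: continuous_fst_snd.
  by move=> s [_ /andP[s0 _] _]; rewrite lerN2; lra.
- apply: (closure_le (f := fun s => s.1)) Pq; first exact: continuous_fst.
  by move=> s [_ /andP[_ sN] _]; rewrite ltW.
- move=> i ik [lt1 lt2].
  have [s [[_ _ /(_ i ik)] Ss /= [s1 s2]]] := Pq _ (filterI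
    (cvgr_gt _ (@continuous_fst_snd q) _ lt1) (cvgr_lt _ (@continuous_fst q) _ lt2)).
  apply: Ss; apply/andP; split; first by move: s1 => /=; lra.
  exact: ltW.
Qed.

(* With A_i = a_i - 1/2 and B_i = b_i - 1/2: the horizontal side with midpoint
   [t] lies in the strip of the polygon and in none of the triangles cut off at
   the top.  The colour only matters for the admissible range of [t.2]. *)
Definition free_site (t : int * int) : bool :=
  (a 1%N + N%:Z - t.2 <= t.1 < b k) &&
  all (fun i => ~~ (a i + N%:Z - t.2 <= t.1 < b i)) (index_iota 1 k.+1).

Lemma free_siteP (t : int * int) : free_site t <->
  [/\ a 1%N + N%:Z - t.2 <= t.1, t.1 < b k &
   forall i, (1 <= i <= k)%N -> t.1 < a i + N%:Z - t.2 \/ b i <= t.1].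
Proof.
rewrite /free_site; split.
  move=> /andP[/andP[h1 h2] /allP h3]; split => // i ik.
  have := h3 i; rewrite mem_index_iota ltnS => /(_ ik).
  by rewrite negb_and -ltNge -leNgt => /orP.
move=> [h1 h2 h3]; rewrite h1 h2; apply/allP => i; rewrite mem_index_iota ltnS.
by move=> /h3 H; rewrite negb_and -ltNge -leNgt; apply/orP.
Qed.

Lemma ler_int1 (x y : int) : x < y -> x%:~R + 1 <= y%:~R :> R.
Proof. by rewrite -[1]/(1%:~R) -rmorphD ler_int lezD1. Qed.

(** Three test points give necessity: the ends of the hypotenuse yield the bounds on level and
    position, and the centroid, an interior point, avoids the removed regions. Conversely the open
    triangle satisfies the strict inequalities. *)
Lemma white_triangle_polygon (t : int * int) :
  white_triangle t `<=` polygon k N A B <-> (1 <= t.2 <= N%:Z) /\ free_site t.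
Proof.
case: t => x n; rewrite /white_triangle /=; set T := triangle _ _ _.
have E1 (c1 c2 c3 : R) : c1 + c2 + c3 = 1 ->
    c1 * (x%:~R - 2^-1) + c2 * (x%:~R + 2^-1) + c3 * (x%:~R + 2^-1) = x%:~R + 2^-1 - c1.
  by move=> h; rewrite (_ : c3 = 1 - c1 - c2); [field|lra].
have E2 (c1 c2 c3 : R) : c1 + c2 + c3 = 1 ->
    c1 * n%:~R + c2 * n%:~R + c3 * (n%:~R - 1) = n%:~R - c3.
  by move=> h; rewrite (_ : c3 = 1 - c1 - c2); [ring|lra].
have EN : N%:Z%:~R = N%:R :> R by [].
rewrite free_siteP /=; split.
  move=> TP.
  have i0 : 0 <= 0 :> R by []. have i1 : 0 <= 1 :> R by [].
  have i3 : 0 <= 3^-1 :> R by lra.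
  have s1 : 1 + 0 + 0 = 1 :> R by lra. have s2 : 0 + 1 + 0 = 1 :> R by lra.
  have s3 : 0 + 0 + 1 = 1 :> R by lra.
  have s4 : 3^-1 + 3^-1 + 3^-1 = 1 :> R by lra.
  have nec (c1 c2 c3 : R) : 0 <= c1 -> 0 <= c2 -> 0 <= c3 -> c1 + c2 + c3 = 1 ->
      polygon k N A B (x%:~R + 2^-1 - c1, n%:~R - c3).
    move=> h1 h2 h3 h; apply: TP; rewrite -(E1 _ _ _ h) -(E2 _ _ _ h).
    by exists c1, c2, c3.
  have [/= /andP[_ nN] h1 _ _] := polygon_nec (nec 1 0 0 i1 i0 i0 s1).
  have [/= /andP[n1 _] _ h2 _] := polygon_nec (nec 0 0 1 i0 i0 i1 s3).
  have [/= _ _ _ h3] := polygon_nec (nec 3^-1 3^-1 3^-1 i3 i3 i3 s4).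
  split; first by apply/andP; split; rewrite -(ler_int R) /= ?EN; lra.
  split.
  - rewrite lerBlDr -(ler_int R) !rmorphD /= EN; lra.
  - rewrite -lezD1 -(ler_int R) rmorphD /=; lra.
  - move=> i ik; case: (ltrP x (a i + N%:Z - n)) => [|h4]; [by left|right].
    rewrite leNgt; apply/negP => /ler_int1 h5; apply: (h3 i ik).
    move: h4; rewrite lerBlDr -(ler_int R) !rmorphD /= EN.
    by split; lra.
move=> [/andP[n1 nN] [h1 h2 h3]]; apply: triangle_sub_closure => c1 c2 c3 p1 p2 p3 h /=.
have Nn : n%:~R <= N%:R :> R by rewrite -EN ler_int.
have n1' : 1 <= n%:~R :> R by rewrite -[1]/(1%:~R) ler_int.
move: h1; rewrite lerBlDr -(ler_int R) !rmorphD /= EN => h1.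
have h2' := ler_int1 h2.
rewrite E1 // E2 //; split => /=.
- by apply/andP; split; lra.
- by apply/andP; split; lra.
- move=> i ik; case: (h3 i ik) => [|/=].
    rewrite ltrBrDr => /ler_int1; rewrite !rmorphD /= EN.
    by move=> h4 /andP[h5 h6]; lra.
  rewrite -(ler_int R) => h4 /andP[h5 h6]; lra.
Qed.

(** The test points are now all three vertices and the centroid. The apex is one level up, hence the
    bound n < N. *)
Lemma black_triangle_polygon (t : int * int) :
  black_triangle t `<=` polygon k N A B <-> (0 <= t.2 < N%:Z) /\ free_site t.
Proof.
case: t => x n; rewrite /black_triangle /=; set T := triangle _ _ _.
have E1 (c1 c2 c3 : R) : c1 + c2 + c3 = 1 ->
    c1 * (x%:~R - 2^-1) + c2 * (x%:~R + 2^-1) + c3 * (x%:~R - 2^-1) = x%:~R - 2^-1 + c2.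
  by move=> h; rewrite (_ : c3 = 1 - c1 - c2); [field|lra].
have E2 (c1 c2 c3 : R) : c1 + c2 + c3 = 1 ->
    c1 * n%:~R + c2 * n%:~R + c3 * (n%:~R + 1) = n%:~R + c3.
  by move=> h; rewrite (_ : c3 = 1 - c1 - c2); [ring|lra].
have EN : N%:Z%:~R = N%:R :> R by [].
rewrite free_siteP /=; split.
  move=> TP.
  have i0 : 0 <= 0 :> R by []. have i1 : 0 <= 1 :> R by [].
  have i3 : 0 <= 3^-1 :> R by lra.
  have s1 : 1 + 0 + 0 = 1 :> R by lra. have s2 : 0 + 1 + 0 = 1 :> R by lra.
  have s3 : 0 + 0 + 1 = 1 :> R by lra.
  have s4 : 3^-1 + 3^-1 + 3^-1 = 1 :> R by lra.
  have nec (c1 c2 c3 : R) : 0 <= c1 -> 0 <= c2 -> 0 <= c3 -> c1 + c2 + c3 = 1 ->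
      polygon k N A B (x%:~R - 2^-1 + c2, n%:~R + c3).
    move=> h1 h2 h3 h; apply: TP; rewrite -(E1 _ _ _ h) -(E2 _ _ _ h).
    by exists c1, c2, c3.
  have [/= /andP[n0 _] h1 _ _] := polygon_nec (nec 1 0 0 i1 i0 i0 s1).
  have [/= _ _ h2 _] := polygon_nec (nec 0 1 0 i0 i1 i0 s2).
  have [/= /andP[_ nN] _ _ _] := polygon_nec (nec 0 0 1 i0 i0 i1 s3).
  have [/= _ _ _ h3] := polygon_nec (nec 3^-1 3^-1 3^-1 i3 i3 i3 s4).
  split; first by apply/andP; split; [rewrite -(ler_int R) /=; lra|
    rewrite -lezD1 -(ler_int R) rmorphD /= EN; lra].
  split.
  - rewrite lerBlDr -(ler_int R) !rmorphD /= EN; lra.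
  - rewrite -lezD1 -(ler_int R) rmorphD /=; lra.
  - move=> i ik; case: (ltrP x (a i + N%:Z - n)) => [|h4]; [by left|right].
    rewrite leNgt; apply/negP => /ler_int1 h5; apply: (h3 i ik).
    move: h4; rewrite lerBlDr -(ler_int R) !rmorphD /= EN.
    by split; lra.
move=> [/andP[n1 nN] [h1 h2 h3]]; apply: triangle_sub_closure => c1 c2 c3 p1 p2 p3 h /=.
have Nn : n%:~R + 1 <= N%:R :> R := ler_int1 nN.
have n1' : 0 <= n%:~R :> R by rewrite -[0]/(0%:~R) ler_int.
move: h1; rewrite lerBlDr -(ler_int R) !rmorphD /= EN => h1.
have h2' := ler_int1 h2.
rewrite E1 // E2 //; split => /=.
- by apply/andP; split; lra.
- by apply/andP; split; lra.
- move=> i ik; case: (h3 i ik) => [|/=].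
    rewrite ltrBrDr => /ler_int1; rewrite !rmorphD /= EN.
    by move=> h4 /andP[h5 h6]; lra.
  rewrite -(ler_int R) => h4 /andP[h5 h6]; lra.
Qed.

End Polygon.
End Geometry.

(** * The vertex classes as sets of free sites, and their cardinalities *)

Section Sites.
Variables (R : realType) (k N : nat) (a b : nat -> int).
Local Notation A := (fun i => (a i)%:~R - 2^-1 : R).
Local Notation B := (fun i => (b i)%:~R - 2^-1 : R).
Implicit Types t : int * int.

Lemma finite_sites (P : int * int -> Prop) :
  (forall t, P t -> 0 <= t.2 <= N%:Z /\ free_site k N a b t) -> finite_set P.
Proof.
move=> PP.
pose s := [seq (a 1%N + i%:Z, j%:Z) |
  i <- iota 0 (absz (b k - a 1%N)%R), j <- iota 0 N.+1].
apply: (@sub_finite_set _ _ [set` s]) =>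
  [[x n] /PP[/= /andP[n0 nN] /free_siteP[/= h1 h2 _]]|];
  last exact: finite_seq.
apply/allpairsP; exists (absz (x - a 1%N)%R, absz n).
by split; [rewrite mem_iota /=; lia|rewrite mem_iota /=; lia|congr (_, _) => /=; lia].
Qed.

Lemma mem_whites t :
  (t \in whites k N A B) = (1 <= t.2 <= N%:Z) && free_site k N a b t.
Proof.
rewrite in_fset_set; last first.
  apply: finite_sites => u /= /white_triangle_polygon[/andP[n1 nN] fu].
  by split => //; lia.
apply/idP/andP; first by rewrite inE /= => /white_triangle_polygon.
by move=> tP; rewrite inE /=; apply/white_triangle_polygon.
Qed.

Lemma mem_blacks t :
  (t \in blacks k N A B) = (0 <= t.2 < N%:Z) && free_site k N a b t.
Proof.
rewrite in_fset_set; last first.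
  apply: finite_sites => u /= /black_triangle_polygon[/andP[n1 nN] fu].
  by split => //; lia.
apply/idP/andP; first by rewrite inE /= => /black_triangle_polygon.
by move=> tP; rewrite inE /=; apply/black_triangle_polygon.
Qed.

Lemma card_fset_seq (T : choiceType) (X : {fset T}) (s : seq T) :
  uniq s -> (forall u, (u \in X) = (u \in s)) -> #|` X| = size s.
Proof.
by move=> us Xs; apply: perm_size; apply: uniq_perm.
Qed.

Section Counting.
Variable L : seq int.
Hypothesis N_gt0 : (0 < N)%N.
Hypotheses (uL : uniq L) (sL : size L = N).
Hypothesis memL : forall p, p \in L <-> (exists2 i, (1 <= i <= k)%N & a i <= p < b i).
Hypothesis rangeL : forall p, p \in L -> a 1%N <= p < b k.
Hypothesis len_le : forall i, (1 <= i <= k)%N -> b i - a i <= N%:Z.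

(** An interval of length at most N leaves no x with a_i + N <= x < b_i, so nothing is cut off on
    level 0. *)
Lemma free_site_bottom (x : int) :
  free_site k N a b (x, 0) = (a 1%N + N%:Z <= x < b k).
Proof.
apply/idP/idP => [/free_siteP[/= h1 h2 _]|/andP[h1 h2]]; first lia.
apply/free_siteP; split => /= [||i ik]; [lia|lia|].
have := len_le ik; lia.
Qed.

Lemma free_site_top (x : int) :
  free_site k N a b (x, N%:Z) = (a 1%N <= x < b k) && (x \notin L).
Proof.
apply/idP/idP => [/free_siteP[/= h1 h2 h3]|/andP[h1 h2]].
  apply/andP; split; first lia.
  by apply/negP => /memL[i ik xi]; case: (h3 i ik); lia.
apply/free_siteP; split => /= [||i ik]; [lia|lia|].
have [xa|ax] := ltrP x (a i); first by left; lia.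
have [bx|xb] := lerP (b i) x; first by right.
by case/negP: h2; apply/memL; exists i => //; apply/andP.
Qed.

(** Both colours have the same sites on levels 1 to N - 1. There remain the white sites on level N,
    which are the holes between the particles, and the black sites on level 0; there are b_k - a_1 -
    N of each. *)
Lemma card_whites_blacks : #|{: whites k N A B}| = #|{: blacks k N A B}|.
Proof.
rewrite -!cardfE -(cardfsID (blacks k N A B) (whites k N A B)).
rewrite -(cardfsID (whites k N A B) (blacks k N A B)) fsetIC; congr (_ + _)%N.
have ab : a 1%N < b k.
  case: L sL rangeL N_gt0 => [<- //|p L' _ /(_ p (mem_head _ _))]; lia.
pose h (i : nat) : int := a 1%N + i%:Z.
pose I : seq int := [seq h i | i <- iota 0 (absz (b k - a 1%N)%R)].
have uI : uniq I by rewrite map_inj_uniq ?iota_uniq // /h => i j; lia.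
have memI (x : int) : (x \in I) = (a 1%N <= x < b k).
  apply/mapP/idP => [[j]|xab].
    by rewrite mem_iota /h => /andP[_ jj] ->; lia.
  by exists (absz (x - a 1%N)%R); [rewrite mem_iota /=; lia|rewrite /h; lia].
have sF : (size [seq x <- I | x \notin L] + N)%N = size I.
  rewrite -sL addnC -(count_predC (mem L) I) !size_filter; congr (_ + _)%N.
  rewrite -size_filter; apply: perm_size; apply: uniq_perm => //.
    exact: filter_uniq.
  move=> x; rewrite mem_filter memI; apply/idP/andP => [xL|[] //].
  by split => //; apply: rangeL.
have sI : size I = absz (b k - a 1%N)%R by rewrite size_map size_iota.
rewrite (@card_fset_seq _ _ [seq (x, N%:Z) | x <- I & x \notin L]); first last.
- move=> [x n]; rewrite inE mem_whites mem_blacks /=.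
  apply/idP/mapP => [/andP[h1 /andP[h2 fx]]|[z]].
    have En : n = N%:Z by move: h1; rewrite fx andbT; lia.
    exists x; last by rewrite En.
    by move: fx; rewrite En free_site_top mem_filter memI andbC.
  rewrite mem_filter memI => /andP[h1 h2] [-> ->].
  by rewrite free_site_top h1 h2 /=; lia.
- by rewrite map_inj_uniq ?filter_uniq // => x y [].
rewrite (@card_fset_seq _ _ [seq (a 1%N + N%:Z + i%:Z, 0 : int) |
    i <- iota 0 (size I - N)]); first last.
- move=> [x n]; rewrite inE mem_whites mem_blacks /=.
  apply/idP/mapP => [/andP[h1 /andP[h2 fx]]|[z]].
    have En : n = 0 by move: h1; rewrite fx andbT; lia.
    move: fx; rewrite En free_site_bottom => fx.
    exists (absz (x - a 1%N - N%:Z)%R); [by rewrite mem_iota /=; lia|].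
    by congr (_, _) => /=; lia.
  by rewrite mem_iota => h1 [-> ->]; rewrite free_site_bottom; lia.
- by rewrite map_inj_uniq ?iota_uniq // => x y []; lia.
by rewrite size_map [RHS]size_map size_iota -sF addnK.
Qed.

End Counting.
End Sites.

(** * Inversion of the Kasteleyn matrix *)

Section Inversion.

Lemma mulmx1_comm (F : comUnitRingType) (m n : nat)
    (M : 'M[F]_(m, n)) (M' : 'M[F]_(n, m)) :
  m = n -> M *m M' = 1%:M -> M' *m M = 1%:M.
Proof. by move=> mn; subst n; exact: mulmx1C. Qed.

(** Serves to replace the sum over all black triangles by one over the three possible neighbours of
    a white one, with an indicator of membership in the graph. *)
Lemma sum_mem_swap (F : nzRingType) (T : eqType) (s1 s2 : seq T) (G : T -> F) :
  uniq s1 -> uniq s2 ->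
  \sum_(t <- s1) (t \in s2)%:R * G t = \sum_(t <- s2) (t \in s1)%:R * G t.
Proof.
move=> u1 u2.
have E (s s' : seq T) : \sum_(t <- s) (t \in s')%:R * G t =
    \sum_(t <- [seq t <- s | t \in s']) G t.
  rewrite big_filter [RHS]big_mkcond; apply: eq_bigr => t _.
  by case: ifP; rewrite ?mul1r ?mul0r.
rewrite !E; apply: perm_big; apply: uniq_perm; rewrite ?filter_uniq //.
by move=> t; rewrite !mem_filter andbC.
Qed.

Variables (R : realType) (k N : nat) (a b : nat -> int) (L : seq int).
Local Notation C := R[i].
Local Notation A := (fun i => (a i)%:~R - 2^-1 : R).
Local Notation B := (fun i => (b i)%:~R - 2^-1 : R).
Hypotheses (uL : uniq L) (sL : size L = N).
Hypothesis memL : forall p, p \in L <-> (exists2 i, (1 <= i <= k)%N & a i <= p < b i).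
Hypothesis rangeL : forall p, p \in L -> a 1%N <= p < b k.

(** The sign turns the alternating relation [lattice_kernel_rec] into a sum with coefficients 1. On
    the graph [absz] is faithful, all levels being nonnegative. *)
Definition signed_kernel (t w : int * int) : C :=
  (-1) ^ (t.1 - w.1 + t.2 - w.2) *
  lattice_kernel C L N w.1 (absz w.2) t.1 (absz t.2).

(** One level below a free site, both x' and x' + 1 still avoid the regions cut off at the top. Only
    the outer sides can fail, at y = b_k or one step left of the slanted side. *)
Lemma kernel_outside (x y : int) (n m : nat) (x' : int) :
  (1 <= m.+1 <= N)%N -> (1 <= n <= N)%N ->
  free_site k N a b (x, n%:Z) -> free_site k N a b (x', m.+1%:Z) ->
  y = x' \/ y = x' + 1 ->
  (y, m%:Z) \notin blacks k N A B -> lattice_kernel C L N x n y m = 0.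
Proof.
move=> mN nN /free_siteP[/= x1 x2 x3] /free_siteP[/= z1 z2 z3] yx.
rewrite mem_blacks /= => nfree.
have {}nfree : ~ free_site k N a b (y, m%:Z).
  by move=> fy; move: nfree; rewrite fy andbT; lia.
have [Eb|nb] := eqVneq y (b k).
  apply: lattice_kernel_right => [p /rangeL|]; first by rewrite Eb => /andP[].
  by rewrite Eb.
have [Ea|na] := eqVneq y (a 1%N + N%:Z - m%:Z - 1).
  apply: (@lattice_kernel_left _ L N x n y m (a 1%N)) => //; last lia.
  by move=> p /rangeL/andP[].
case: nfree; apply/free_siteP; split => /= [||i ik]; [lia|lia|].
have := z3 i ik; lia.
Qed.

Lemma kernel_inverse_eq (w w' : int * int) :
  w \in whites k N A B -> w' \in whites k N A B ->
  \sum_(t <- blacks k N A B) (share_side w' t)%:R * signed_kernel t w = (w' == w)%:R.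
Proof.
case: w => x n; case: w' => x' n'; rewrite !mem_whites.
move=> /andP[/= nN fw] /andP[/= nN' fw'].
case: n nN fw => [n|n] nN fw; last by case/andP: nN.
case: n' nN' fw' => [n'|n'] nN' fw'; last by case/andP: nN'.
rewrite sum_mem_swap ?fset_uniq //; last first.
  rewrite /= !inE !xpair_eqE; lia.
have mN' : (1 <= n' <= N)%N by lia.
case: n' mN' nN' fw' => [//|m] mN' nN' fw'.
have Em : m.+1%:Z - 1 = m%:Z by lia.
rewrite !big_cons big_nil addr0 /= Em.
have out y : y = x' \/ y = x' + 1 ->
    ((y, m%:Z) \in blacks k N A B)%:R * signed_kernel (y, m%:Z) (x, n%:Z) =
    signed_kernel (y, m%:Z) (x, n%:Z).
  move=> yx; case yb : (_ \in _); first by rewrite mul1r.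
  have nN1 : (1 <= n <= N)%N by lia.
  have /negbT nyb := yb.
  by rewrite /signed_kernel /= (kernel_outside mN' nN1 fw fw' yx nyb) mulr0 mul0r.
(* The lower neighbours lose their indicator, as the kernel vanishes where they leave the graph. *)
rewrite (out x' (or_introl erefl)) (out (x' + 1) (or_intror erefl)).
(* The third neighbour has the same free site as the white triangle, so it is in the graph unless m
   + 1 = N. *)
rewrite mem_blacks fw' andbT /=.
rewrite /signed_kernel /=.
set e : C := (-1) ^ (x' - x + m.+1%:Z - n%:Z).
have e2 : (-1) ^ (x' - x + m%:Z - n%:Z) = - e :> C.
  rewrite /e (_ : x' - x + m.+1%:Z - n%:Z = x' - x + m%:Z - n%:Z + 1); last lia.
  by rewrite [in RHS]expfzDr ?oppr_eq0 ?oner_eq0 // expr1z mulrN1 opprK.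
have e3 : (-1) ^ (x' + 1 - x + m%:Z - n%:Z) = e :> C.
  by rewrite /e; congr (_ ^ _); lia.
rewrite e2 e3.
(* On level N a white site of the graph is a hole between particles. *)
have xL : m.+1 = N -> x' \notin L.
  move=> mN; apply/negP => /memL[i ik xi].
  move/free_siteP: fw' => /= [_ _ /(_ i ik)]; lia.
have nN1 : (n <= N)%N by lia.
have mN1 : (m.+1 <= N)%N by lia.
have := lattice_kernel_rec C x mN1 nN1 (ltn0Sn m) xL.
rewrite /=.
set K1 := lattice_kernel _ _ _ _ _ _ m.+1; set K2 := lattice_kernel _ _ _ _ _ _ m.
set K3 := lattice_kernel _ _ _ _ _ _ m => H.
transitivity (e * ((if m.+1 == N then 0 else K1) - K2 + K3)).
  rewrite (_ : ((0 <= m.+1%:Z < N%:Z)%R%:R : C) = (m.+1 != N)%:R); last first.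
    by congr (_%:R); lia.
  by case: eqP => _ /=; ring.
rewrite H xpair_eqE eqz_nat; case: eqVneq => [Ex|_] /=; last by rewrite mulr0.
case: eqVneq => [En|_] /=; last by rewrite mulr0.
by rewrite mulr1 /e Ex En subrr add0r subrr.
Qed.

End Inversion.

(** Allows the end points to be replaced by a_i - 1/2 and b_i - 1/2 at every index, the form assumed
    by the results on triangles. *)
Lemma eq_polygon (R : realType) (k N : nat) (A B A' B' : nat -> R) : (0 < k)%N ->
  (forall i, (1 <= i <= k)%N -> A i = A' i) ->
  (forall i, (1 <= i <= k)%N -> B i = B' i) ->
  polygon k N A B = polygon k N A' B'.
Proof.
move=> k0 AA' BB'; rewrite /polygon; congr closure.
apply/seteqP; split => p [/= h1 h2 h3]; split => //=.
- by rewrite -AA' -?BB' ?k0 ?leqnn.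
- by move=> i ik; rewrite -AA' // -BB' //; exact: h3.
- by rewrite AA' ?BB' ?k0 ?leqnn.
- by move=> i ik; rewrite AA' // BB' //; exact: h3.
Qed.

Theorem theorem6p1 (R : realType) (k N : nat) (A B : nat -> R) (nu : nat -> int)
  (hk : (2 <= k)%N) (hN : (1 <= N)%N)
  (hA : forall i : nat, (1 <= i <= k)%N -> A i - 2^-1 \is a Num.int)
  (hB : forall i : nat, (1 <= i <= k)%N -> B i - 2^-1 \is a Num.int)
  (hAB : forall i : nat, (1 <= i <= k)%N -> A i < B i)
  (hBA : forall i : nat, (1 <= i < k)%N -> B i < A i.+1)
  (hsum : \sum_(1 <= i < k.+1) (B i - A i) = N%:R)
  (hnu : top_row k N A B nu) :
  exists2 Kinv : 'M[R[i]]_(#|{: blacks k N A B}|, #|{: whites k N A B}|),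
    is_inverse_mx (Kast k N A B) Kinv &
    forall (b : blacks k N A B) (w : whites k N A B),
      let: (y, m) := val b : int * int in
      let: (x, n) := val w : int * int in
      forall gz gw : R -> R[i],
        z_contour N nu gz y -> w_contour N gw gz x n ->
        Kinv (enum_rank b) (enum_rank w) =
          (-1) ^ (y - x + m - n) * corr_kernel N nu gz gw x n y m.
Proof.
(* For 1 <= i <= k the floors are exact, so a_i = A_i + 1/2 and b_i = B_i + 1/2; the particles are
   then the integers p with a_i <= p < b_i. *)
pose a i := Num.floor (A i - 2^-1) + 1; pose b i := Num.floor (B i - 2^-1) + 1.
have k0 : (0 < k)%N by rewrite ltnW.
have Aa i : (1 <= i <= k)%N -> A i = (a i)%:~R - 2^-1.
  by move=> /hA/floorK; rewrite /a rmorphD /= => ->; field.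
have Bb i : (1 <= i <= k)%N -> B i = (b i)%:~R - 2^-1.
  by move=> /hB/floorK; rewrite /b rmorphD /= => ->; field.
have ab i : (1 <= i <= k)%N -> a i < b i.
  by move=> ik; have := hAB i ik; rewrite Aa // Bb // ltrD2r ltr_int.
have ba i : (1 <= i < k)%N -> b i < a i.+1.
  move=> ik; have := hBA i ik; rewrite Aa ?Bb; [|lia|lia].
  by rewrite ltrD2r ltr_int.
have a_le i : (1 <= i <= k)%N -> a 1%N <= a i.
  elim: i => [//|[_|i IH] ik] //.
  have h1 := IH ltac:(lia); have h2 := ab i.+1 ltac:(lia).
  have h3 := ba i.+1 ltac:(lia); lia.
have b_le d : (d < k)%N -> b (k - d)%N <= b k.
  elim: d => [|d IH] dk; first by rewrite subn0.
  have h1 := IH ltac:(lia); have h2 := ab (k - d)%N ltac:(lia).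
  have := ba (k - d.+1)%N ltac:(lia).
  rewrite (_ : (k - d.+1).+1 = (k - d)%N); last lia.
  lia.
set L := top_positions nu N.
have [_ nu_lt nuL] := hnu.
have memL p : p \in L <-> (exists2 i, (1 <= i <= k)%N & a i <= p < b i).
  have := nuL p; set Q := exists2 i, _ & a i <= p < b i.
  have -> : (exists2 i : nat, (1 <= i <= k)%N & A i + 2^-1 <= p%:~R <= B i - 2^-1) = Q.
    have E i : (1 <= i <= k)%N ->
        (A i + 2^-1 <= p%:~R <= B i - 2^-1) = (a i <= p < b i).
      move=> ik; rewrite Aa // Bb // subrK.
      rewrite (_ : _ - _ - _ = (b i - 1)%:~R); last by rewrite rmorphB; field.
      by rewrite !ler_int; lia.
    by apply/propext; split => -[i ik h]; exists i => //; move: h; rewrite E.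
  move=> <-; split.
    by move=> /mapP[r]; rewrite mem_index_iota ltnS => rN ->; exists r.
  by move=> [r rN <-]; apply/mapP; exists r; rewrite // mem_index_iota ltnS.
have nu_dec (r s : nat) : (1 <= r)%N -> (r < s <= N)%N -> nu s - s%:Z < nu r - r%:Z.
  move=> r1; elim: s => [|s IH] // /andP[rs sN].
  have [->|rs'] := eqVneq r s; first by apply: nu_lt; lia.
  by apply: lt_trans (IH _); [apply: nu_lt; lia|lia].
have uL : uniq L.
  rewrite map_inj_in_uniq ?iota_uniq // => r s; rewrite !mem_index_iota => rN sN rs.
  have [rs'|sr|//] := ltngtP r s.
    by have := nu_dec r s ltac:(lia) ltac:(lia); rewrite rs ltxx.
  by have := nu_dec s r ltac:(lia) ltac:(lia); rewrite rs ltxx.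
have sL : size L = N by rewrite size_map size_iota subn1.
have rangeL p : p \in L -> a 1%N <= p < b k.
  move=> /memL[i ik pi]; have h1 := a_le i ik.
  have h2 := b_le (k - i)%N ltac:(lia); rewrite subKn in h2; lia.
have inL r : (1 <= r <= N)%N -> nu r - r%:Z \in L.
  by move=> rN; apply/mapP; exists r; rewrite // mem_index_iota ltnS.
have nu_le r : (1 <= r <= N)%N -> nu N - N%:Z <= nu r - r%:Z <= nu 1%N - 1.
  move=> rN; apply/andP; split.
    by have [->//|rN'] := eqVneq r N; apply/ltW/nu_dec; lia.
  by have [->//|r1] := eqVneq r 1%N; apply/ltW/nu_dec; lia.
(* Both sides are the least particle: each is one and bounds all of them from below. *)
have nuN : nu N - N%:Z = a 1%N.
  have : a 1%N \in L by apply/memL; exists 1%N; rewrite ?lexx ?ab ?k0.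
  move=> /mapP[r]; rewrite mem_index_iota ltnS => rN E.
  have := nu_le r rN; have := rangeL _ (inL N ltac:(lia)); lia.
have nu1 : nu 1%N - 1 = b k - 1.
  have : b k - 1 \in L.
    by apply/memL; exists k; rewrite ?k0 ?leqnn //; have := ab k ltac:(lia); lia.
  move=> /mapP[r]; rewrite mem_index_iota ltnS => rN E.
  have := nu_le r rN; have := rangeL _ (inL 1%N ltac:(lia)); lia.
(* The other intervals contribute nonnegative lengths to the total N. *)
have len_le i : (1 <= i <= k)%N -> b i - a i <= N%:Z.
  move=> ik; rewrite -(ler_int R) -[N%:Z%:~R]/(N%:R : R) -hsum rmorphB /=.
  rewrite (bigD1_seq i) ?mem_index_iota ?iota_uniq //= ?ltnS // Aa // Bb //.
  rewrite opprB addrA subrK lerDl big_seq_cond sumr_ge0 // => j.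
  by rewrite mem_index_iota ltnS => /andP[jk _]; rewrite subr_ge0 ltW ?hAB.
pose A' i : R := (a i)%:~R - 2^-1; pose B' i : R := (b i)%:~R - 2^-1.
have EP : polygon k N A B = polygon k N A' B' by apply: eq_polygon.
have EW : whites k N A B = whites k N A' B' by rewrite /whites EP.
have EB : blacks k N A B = blacks k N A' B' by rewrite /blacks EP.
(* The finite sum makes the inverse independent of the contours, which are quantified only
   afterwards. *)
pose Kinv : 'M[R[i]]_(#|{: blacks k N A B}|, #|{: whites k N A B}|) :=
  \matrix_(i, j) signed_kernel R N L (val (enum_val i)) (val (enum_val j)).
have card_eq : #|{: whites k N A B}| = #|{: blacks k N A B}|.
  by rewrite EW EB; apply: (@card_whites_blacks R k N a b L).
have KK : Kast k N A B *m Kinv = 1%:M.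
  apply/matrixP => i j; rewrite !mxE.
  pose G (t : int * int) := (share_side (val (enum_val i)) t)%:R *
    signed_kernel R N L t (val (enum_val j)).
  transitivity (\sum_(t <- blacks k N A B) G t).
    rewrite big_seq_fsetE /= [RHS](reindex _ (onW_bij _ (enum_val_bij _))).
    by apply: eq_bigr => l _; rewrite !mxE.
  have iW := valP (enum_val i); have jW := valP (enum_val j).
  rewrite EB (@kernel_inverse_eq R k N a b L) -?EW //.
  by rewrite (inj_eq val_inj) (inj_eq enum_val_inj).
exists Kinv; first by split => //; exact: mulmx1_comm KK.
move=> t w; case Et: (val t) => [y m]; case Ew: (val w) => [x n] gz gw zc wc.
rewrite mxE !enum_rankK Et Ew /signed_kernel /=; congr (_ * _).
have := valP t; rewrite Et EB mem_blacks => /andP[/= mN _].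
have := valP w; rewrite Ew EW mem_whites => /andP[/= nN /free_siteP[/= x1 x2 _]].
case: n nN x1 wc {Ew} => [n|n] nN x1 wc; last by case/andP: nN.
case: m mN zc {Et} => [m|m] mN zc; last by case/andP: mN.
(* The bounds on x come from the free site of [w], through nu_N - N = a_1 and nu_1 - 1 = b_k - 1. *)
symmetry; apply: corr_kernel_lattice => //; lia.
Qed.
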